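(* Let $r\ge 1$, let $d'<d$ be natural numbers and let $\tau$ be an $r$-type all of whose members $(B,b)$ satisfy that $B$ has maximum degree at most $d'$. Then $\tau$-neighbourhood freeness is uniformly testable on the class $\mathcal{C}_d$ with constant running time.
   Context: $\mathcal{C}_d$ is the class of finite simple undirected graphs of maximum degree at most $d$. For a graph $G$ and vertex $v$, $N_r^G(v)$ is the set of vertices at distance at most $r$ from $v$ and $\mathcal{N}_r^G(v)$ the subgraph induced by it. An $r$-ball is a pair $(B,b)$ of a graph $B$ and $b\in V(B)$ such that every vertex of $B$ has distance at most $r$ from $b$; two $r$-balls are isomorphic if there is a graph isomorphism mapping centre to centre. An $r$-type is an isomorphism class of $r$-balls; $v$ has $r$-type $\tau$ in $G$ if $(\mathcal{N}_r^G(v),v)\in\tau$. $G$ is $\tau$-neighbourhood free if no vertex of $G$ has type $\tau$. A graph on $n$ vertices is $\epsilon$-far from a property $\mathcal{P}$ if more than $\epsilon dn$ edge insertions/deletions are needed to obtain an $n$-vertex graph of $\mathcal{P}$. The algorithm gets $n$ and oracle access answering queries $(v,i)$, $i\le d$, with the $i$-th neighbour of $v$ (or a special symbol). Uniformly testable with constant running time means: there is a single probabilistic algorithm which, given $\epsilon\in(0,1]$, $n$, and oracle access to $G\in\mathcal{C}_d$ on $n$ vertices, accepts with probability at least $2/3$ if $G$ has the property and rejects with probability at least $2/3$ if $G$ is $\epsilon$-far from it, and whose running time is bounded by a function of $\epsilon$ (for fixed $d,\tau$), independent of $n$. *)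

(* Defs.v *)
From HB Require Import structures.
From mathcomp Require Import all_boot all_order all_algebra.
From mathcomp Require Import reals.
Set Implicit Arguments.
Unset Strict Implicit.
Unset Printing Implicit Defensive.
Import Order.TTheory GRing.Theory Num.Theory.

Record graph (V : finType) := Graph {
  edge : rel V;
  edge_sym : symmetric edge;
  edge_irr : irreflexive edge }.

Section Graphs.
Variable V : finType.
Implicit Types G H : graph V.

Definition max_degree G : nat := \max_(v : V) #|[set w | edge G v w]|.

Definition edge_set G : {set {set V}} :=
  [set e | [exists x, exists y, edge G x y && (e == [set x; y])]].

(* Least number of edge insertions and deletions turning G into H. *)
Definition edit_dist G H : nat :=
  #|(edge_set G :\: edge_set H) :|: (edge_set H :\: edge_set G)|.

(* dist_le G r x y: some walk of length at most r leads from x to y, i.e. the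
   distance of x and y is at most r. *)
Definition dist_le G (r : nat) (x y : V) : bool :=
  [exists k : 'I_r.+1, exists p : k.-tuple V,
    path (edge G) x p && (last x p == y)].

Definition nbhd G (r : nat) (v : V) : {set V} := [set w | dist_le G r v w].

Lemma nbhd_centre G r v : v \in nbhd G r v.
Proof.
rewrite inE; apply/existsP; exists ord0; apply/existsP; exists [tuple].
by rewrite /= eqxx.
Qed.

Definition induced_edge G (A : {set V}) : rel {x : V | x \in A} :=
  fun x y => edge G (val x) (val y).

Lemma induced_sym G A : symmetric (@induced_edge G A).
Proof. by move=> x y; apply: edge_sym. Qed.

Lemma induced_irr G A : irreflexive (@induced_edge G A).
Proof. by move=> x; apply: edge_irr. Qed.

Definition induced G (A : {set V}) : graph {x : V | x \in A} :=
  Graph (@induced_sym G A) (@induced_irr G A).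

End Graphs.

(* A pair (B, b) of a finite graph and one of its vertices. *)
Record rooted := Rooted {
  bvertex : finType;
  bgraph : graph bvertex;
  centre : bvertex }.

Definition is_ball (r : nat) (B : rooted) : Prop :=
  forall x, dist_le (bgraph B) r (centre B) x.

Definition rooted_iso (B C : rooted) : Prop :=
  exists f : bvertex B -> bvertex C,
    [/\ bijective f,
        forall x y, edge (bgraph C) (f x) (f y) = edge (bgraph B) x y
      & f (centre B) = centre C].

Record rtype (r : nat) := RType {
  rtype_mem :> rooted -> Prop;
  rtype_class : exists2 B, is_ball r B &
    forall C, rtype_mem C <-> is_ball r C /\ rooted_iso B C }.

Definition nbhd_ball (V : finType) (G : graph V) (r : nat) (v : V) : rooted :=
  Rooted (induced G (nbhd G r v)) (exist _ v (nbhd_centre G r v)).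

Definition has_type r (tau : rtype r) (V : finType) (G : graph V) (v : V) :
  Prop := tau (nbhd_ball G r v).

Definition graph_property := forall n : nat, graph 'I_n -> Prop.

Definition nbhd_free r (tau : rtype r) : graph_property :=
  fun n G => forall v : 'I_n, ~ has_type tau G v.

(* Adjacency lists giving, for each vertex, some enumeration without
   repetition of its neighbours; the order is arbitrary. *)
Definition adj_lists n (G : graph 'I_n) (adj : 'I_n -> seq 'I_n) : Prop :=
  forall v, uniq (adj v) /\ adj v =i edge G v.

(* Probabilistic random access machines with a structured syntax. The memory
   is an array of natural numbers, initially all 0. Every command costs one
   step; an expression is evaluated within the step of its command, which is
   only a constant factor since expressions are part of the fixed program. In
   a bounded number of steps all values stay polynomial in the number n of
   vertices, so unit cost arithmetic agrees, up to a factor independent of n,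
   with arithmetic on words of O(log n) bits. *)

Inductive binop := Add | Sub | Mul | Div | Mod | Eq | Le.

Inductive expr :=
  | Const of nat
  | Nvert                   (* the number of vertices of the input graph *)
  | Cell of expr            (* the content of a cell, by indirect addressing *)
  | Bin of binop & expr & expr
  | LeEps of expr & expr.   (* LeEps a b is 1 if a <= eps * b, and 0 if not *)

Inductive cmd :=
  | Skip
  | Store of expr & expr              (* Store a e: cell a becomes e *)
  | Query of expr & expr & expr       (* Query a v i: cell a becomes the
                                         answer to the query (v, i) *)
  | Rand of expr & expr               (* Rand a k: cell a becomes a uniformly
                                         random number below k *)
  | Seq of cmd & cmd
  | If of expr & cmd & cmd
  | While of expr & cmd.

Definition memory := nat -> nat.

(* The commands still to be executed, and the memory. *)
Definition config := (seq cmd * memory)%type.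

Definition binop_eval (o : binop) (x y : nat) : nat :=
  match o with
  | Add => x + y
  | Sub => x - y
  | Mul => x * y
  | Div => x %/ y
  | Mod => x %% y
  | Eq => x == y
  | Le => x <= y
  end.

Definition update (m : memory) (a x : nat) : memory :=
  fun b => if b == a then x else m b.

Section Semantics.
Variables (R : realType) (eps : R) (n d : nat) (adj : 'I_n -> seq 'I_n).

(* Vertices are numbered 0, ..., n - 1 and neighbours 0, ..., d - 1. The
   answer is w + 1 if the i-th neighbour of v is w; the special symbol is 0. *)
Definition oracle (v i : nat) : nat :=
  if insub v is Some u then
    if i < d then nth 0 [seq (val w).+1 | w <- adj u] i else 0
  else 0.

Fixpoint eval (m : memory) (e : expr) : nat :=
  match e with
  | Const k => k
  | Nvert => n
  | Cell a => m (eval m a)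
  | Bin o a b => binop_eval o (eval m a) (eval m b)
  | LeEps a b => ((eval m a)%:R <= eps * (eval m b)%:R)%R
  end.

(* The successors of a configuration, all equally likely. A random choice
   below 0 is read as a random choice below 1. *)
Definition step (c : config) : seq config :=
  let: (k, m) := c in
  match k with
  | [::] => [:: c]
  | Skip :: k => [:: (k, m)]
  | Store a e :: k => [:: (k, update m (eval m a) (eval m e))]
  | Query a v i :: k =>
      [:: (k, update m (eval m a) (oracle (eval m v) (eval m i)))]
  | Rand a e :: k =>
      [seq (k, update m (eval m a) x) | x <- iota 0 (maxn 1 (eval m e))]
  | Seq c1 c2 :: k => [:: (c1 :: c2 :: k, m)]
  | If e c1 c2 :: k => [:: ((if eval m e != 0 then c1 else c2) :: k, m)]
  | While e c :: k =>
      [:: (if eval m e != 0 then c :: While e c :: k else k, m)]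
  end.

Definition halted (c : config) : bool := nilp c.1.

(* A halted computation accepts if cell 0 is nonzero, and rejects if not. *)
Definition verdict (c : config) : bool := c.2 0 != 0.

Definition start (p : cmd) : config := ([:: p], fun=> 0).

(* Whatever the random choices are, c halts after at most t steps. *)
Fixpoint halts_within (t : nat) (c : config) : bool :=
  halted c || (if t is t'.+1 then all (halts_within t') (step c) else false).

(* Probability that c halts after at most t steps with verdict b. *)
Fixpoint prob (b : bool) (t : nat) (c : config) : R :=
  if halted c then (verdict c == b)%:R%R
  else if t is t'.+1 then
    ((\sum_(c' <- step c) prob b t' c') / (size (step c))%:R)%R
  else 0%R.

End Semantics.

Local Open Scope ring_scope.

(* The property is restricted to graphs of maximum degree at most d. *)
Definition eps_far (R : realType) (d : nat) (P : graph_property) (eps : R)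
    n (G : graph 'I_n) : Prop :=
  forall H : graph 'I_n, (max_degree H <= d)%N -> P n H ->
    eps * d%:R * n%:R < (edit_dist G H)%:R.

Definition uniformly_testable_const_time (R : realType) (d : nat)
    (P : graph_property) : Prop :=
  exists (p : cmd) (T : R -> nat), forall eps : R, 0 < eps <= 1 ->
    forall n (G : graph 'I_n) (adj : 'I_n -> seq 'I_n),
      (max_degree G <= d)%N -> adj_lists G adj ->
      [/\ halts_within eps d adj (T eps) (start p),
          P n G -> 2 / 3 <= prob eps d adj true (T eps) (start p)
        & eps_far d P eps G ->
            2 / 3 <= prob eps d adj false (T eps) (start p)].

(* Main.v *)
Require Import Defs.
From mathcomp Require Import all_boot all_order all_algebra.
From mathcomp Require Import zify ring lra.
From mathcomp Require Import boolp reals.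
Set Implicit Arguments.
Unset Strict Implicit.
Unset Printing Implicit Defensive.
Import Order.TTheory GRing.Theory Num.Theory.

(** The tester samples O(1 / eps) vertices and rejects if one of them has type
    tau. It is correct because a graph with n vertices, n large, can be made
    tau-free by O(1) edits per vertex of type tau. A vertex of type tau sees
    only degrees at most d' < d within distance r - 1, so edits whose endpoints
    all end up with degree d create no new vertex of type tau, provided that no
    vertex sees an edited pair at distance exactly r; inserting edges between
    distant vertices and cutting a vertex off from all its neighbours are such
    edits. To destroy the type of v, cut off 2d pairwise distant vertices
    whose neighbours have the same degrees, bring these neighbours back to
    degree d by regular graphs between them, put a K_(d,d) on the 2d vertices,
    and route (d - deg v) / 2 edges of a matching of the K_(d,d) through v.

    Parity is the only obstruction: if d - deg v is odd, another vertex u of odd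
    deficiency is treated together with v. If there is none then d n is odd, and
    u is produced by inserting, next to the K_(d,d), an isolated vertex and a
    tau-free graph of odd order. If no such graph exists, then no graph of odd
    order is tau-free and, for odd n, the tester always rejects. *)

(** * Distances in a graph *)

Lemma card_bigcup_leq (I T : finType) (A : {set I}) (F : I -> {set T}) m :
  (forall i, i \in A -> #|F i| <= m) -> #|\bigcup_(i in A) F i| <= #|A| * m.
Proof.
move=> Fm; rewrite -sum_nat_const; elim/big_rec2: _ => [|i k B Ai leBk].
  by rewrite cards0.
by apply: leq_trans (leq_card_setU _ _) (leq_add (Fm i Ai) leBk).
Qed.

Section Distance.
Variable V : finType.
Implicit Types (G H : graph V) (D X : {set V}) (v w x y z : V).

Definition neighbours G v : {set V} := [set w | edge G v w].

Definition deg G v : nat := #|neighbours G v|.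

Lemma in_neighbours G v w : (w \in neighbours G v) = edge G v w.
Proof. by rewrite inE. Qed.

Lemma eq_neighbours G H v :
  edge G v =1 edge H v -> neighbours G v = neighbours H v.
Proof. by move=> eGH; apply/setP => w; rewrite !in_neighbours eGH. Qed.

Lemma max_degreeP G d : reflect (forall v, deg G v <= d) (max_degree G <= d).
Proof.
apply: (iffP (bigmax_leqP _ _ _)) => [dG v|dG v _]; last exact: dG.
exact: (dG v).
Qed.

Lemma deg_leq G d v : max_degree G <= d -> deg G v <= d.
Proof. by move/max_degreeP. Qed.

Lemma dist_leP G k x y :
  reflect (exists p, [/\ size p <= k, path (edge G) x p & last x p = y])
          (dist_le G k x y).
Proof.
apply: (iffP existsP) => [[j /existsP[p /andP[xp /eqP py]]]|[p [pk xp py]]].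
  by exists p; rewrite size_tuple -ltnS ltn_ord.
exists (@Ordinal k.+1 (size p) pk); apply/existsP; exists (in_tuple p).
by rewrite /= xp py eqxx.
Qed.

Lemma dist_le_refl G k x : dist_le G k x x.
Proof. by apply/dist_leP; exists [::]. Qed.

Lemma dist_le0 G x y : dist_le G 0 x y = (x == y).
Proof.
by apply/dist_leP/eqP => [[[|w p] [//]]|<-]; last by exists [::].
Qed.

Lemma dist_leW G j k x y : j <= k -> dist_le G j x y -> dist_le G k x y.
Proof.
move=> jk /dist_leP[p [pj xp py]]; apply/dist_leP; exists p; split=> //.
exact: leq_trans jk.
Qed.

Lemma dist_leD G j k x y z :
  dist_le G j x y -> dist_le G k y z -> dist_le G (j + k) x z.
Proof.
move=> /dist_leP[p [pj xp py]] /dist_leP[q [qk yq qz]].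
apply/dist_leP; exists (p ++ q).
by rewrite size_cat leq_add // cat_path xp py yq last_cat py qz.
Qed.

Lemma dist_le_edge G x y : edge G x y -> dist_le G 1 x y.
Proof. by move=> xy; apply/dist_leP; exists [:: y]; rewrite /= xy. Qed.

Lemma dist_leSP G k x y :
  reflect (exists2 z, dist_le G k x z & (z == y) || edge G z y)
          (dist_le G k.+1 x y).
Proof.
apply: (iffP idP) => [/dist_leP[p]|[z xz /orP[/eqP<-|zy]]].
- case/lastP: p => [[_ _ <-]|p w].
    by exists x; rewrite ?dist_le_refl ?eqxx.
  rewrite size_rcons last_rcons rcons_path => -[pk /andP[xp pw] <-].
  by exists (last x p); [apply/dist_leP; exists p|rewrite pw orbT].
- exact: dist_leW xz.
- by rewrite -addn1; apply: dist_leD xz _; apply: dist_le_edge.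
Qed.

Lemma dist_le_sym G k : symmetric (dist_le G k).
Proof.
apply: symmetric_from_pre; elim: k => [|k IHk] x y.
  by rewrite !dist_le0 eq_sym.
case/dist_leSP => z /IHk zx /orP[/eqP<-|zy]; first exact: dist_leW zx.
by rewrite -add1n; apply: dist_leD zx; apply: dist_le_edge; rewrite edge_sym.
Qed.

Lemma dist_le_connect G k x y : dist_le G k x y -> connect (edge G) x y.
Proof. by move=> /dist_leP[p [_ xp py]]; apply/connectP; exists p. Qed.

Lemma closed_dist_le G X k x y :
  closed (edge G) X -> dist_le G k x y -> (x \in X) = (y \in X).
Proof. by move=> clX /dist_le_connect; apply: closed_connect. Qed.

Lemma nbhd0 G x : nbhd G 0 x = [set x].
Proof. by apply/setP => y; rewrite !inE dist_le0 eq_sym. Qed.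

Lemma nbhdS G k x :
  nbhd G k.+1 x = \bigcup_(z in nbhd G k x) (z |: neighbours G z).
Proof.
apply/setP => y; rewrite inE; apply/dist_leSP/bigcupP => -[z xz zy]; exists z.
- by rewrite inE.
- by rewrite !inE eq_sym.
- by rewrite inE in xz.
- by rewrite !inE eq_sym in zy.
Qed.

Lemma card_nbhd_leq G d k x : max_degree G <= d -> #|nbhd G k x| <= d.+1 ^ k.
Proof.
move=> /max_degreeP dG; elim: k => [|k IHk]; first by rewrite nbhd0 cards1.
rewrite nbhdS; apply: (@leq_trans (#|nbhd G k x| * d.+1)).
  apply: card_bigcup_leq => z _; rewrite cardsU1 -add1n.
  exact: leq_add (leq_b1 _) (dG z).
by rewrite expnSr leq_mul2r IHk orbT.
Qed.

Definition agree_off D G H : Prop :=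
  forall x, x \notin D -> edge G x =1 edge H x.

Lemma agree_off_neighbours D G H x :
  agree_off D G H -> x \notin D -> neighbours G x = neighbours H x.
Proof. by move=> GH xD; apply: eq_neighbours; apply: GH. Qed.

Lemma agree_off_mem D G H x y :
  agree_off D G H -> edge G x y != edge H x y -> (x \in D) && (y \in D).
Proof.
move=> GH; apply: contraNT; rewrite negb_and.
by case/orP => /GH e; first rewrite e //; rewrite !(edge_sym _ x) e.
Qed.

Lemma agree_off_sym D G H : agree_off D G H -> agree_off D H G.
Proof. by move=> GH x xD y; rewrite GH. Qed.

End Distance.

Section EditDistance.
Variable V : finType.
Implicit Types (G H K : graph V) (D : {set V}).

Lemma edit_dist_refl G : edit_dist G G = 0.
Proof. by rewrite /edit_dist setDv setU0 cards0. Qed.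

Lemma edit_dist_trans G H K :
  edit_dist G K <= edit_dist G H + edit_dist H K.
Proof.
apply: leq_trans (leq_card_setU _ _); apply: subset_leq_card.
apply/subsetP => e; rewrite !(in_setU, in_setD).
by case: (e \in edge_set G); case: (e \in edge_set H); case: (e \in edge_set K).
Qed.

Lemma edge_setD_sub D G H :
  agree_off D G H ->
  edge_set G :\: edge_set H \subset [set [set p.1; p.2] | p in setX D D].
Proof.
move=> GH; apply/subsetP => e /setDP[].
rewrite inE => /existsP[x /existsP[y /andP[xy /eqP->]]].
rewrite inE negb_exists => /forallP/(_ x).
rewrite negb_exists => /forallP/(_ y); rewrite eqxx andbT => nxy.
apply/imsetP; exists (x, y); rewrite // inE.
by apply: (agree_off_mem GH); rewrite xy (negbTE nxy).
Qed.

Lemma agree_off_edit_dist D G H : agree_off D G H -> edit_dist G H <= #|D| ^ 2.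
Proof.
move=> GH; rewrite -mulnn -cardsX.
apply: leq_trans (leq_imset_card (fun p => [set p.1; p.2]) _).
by rewrite subset_leq_card // subUset !edge_setD_sub //; apply: agree_off_sym.
Qed.

End EditDistance.

(** * Types of vertices *)

Definition rtype_degree_le r (tau : rtype r) (d' : nat) : Prop :=
  forall B : rooted, tau B -> max_degree (bgraph B) <= d'.

Section Types.
Variables (r : nat) (tau : rtype r).

(* An isomorphism from B onto the r-ball of v, given as a map into V so that no
   subtype of V is involved. *)
Definition ball_emb (B : rooted) (V : finType) (G : graph V) (v : V)
    (f : bvertex B -> V) : Prop :=
  [/\ injective f,
      forall x y, edge G (f x) (f y) = edge (bgraph B) x y,
      f (centre B) = v
    & nbhd G r v = [set f b | b in [set: bvertex B]]].

Lemma is_ball_nbhd_ball (V : finType) (G : graph V) v :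
  is_ball r (nbhd_ball G r v).
Proof.
suff ball k w (wN : w \in nbhd G r v) : k <= r -> dist_le G k v w ->
    dist_le (induced G (nbhd G r v)) k (exist _ v (nbhd_centre G r v))
            (exist _ w wN).
  by case=> w wN /=; apply: ball => //; rewrite inE in wN.
elim: k w wN => [|k IHk] w wN kr.
  rewrite dist_le0 => /eqP vw; subst w; rewrite dist_le0; apply/eqP.
  exact: val_inj.
case/dist_leSP => z vz zw.
have zN : z \in nbhd G r v by rewrite inE; apply: dist_leW vz; apply: ltnW.
apply/dist_leSP; exists (exist _ z zN); first by apply: IHk => //; apply: ltnW.
by case/orP: zw => zw; apply/orP; [left|right].
Qed.

Lemma ball_emb_iso (B : rooted) (V : finType) (G : graph V) (v : V)
    (f : bvertex B -> V) :
  ball_emb G v f -> rooted_iso B (nbhd_ball G r v).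
Proof.
case=> injf ef cf nf.
have inN b : f b \in nbhd G r v by rewrite nf imset_f.
have injF : injective (fun b => exist _ (f b) (inN b) : {x | x \in nbhd G r v}).
  by move=> x y [] /injf.
exists (fun b => exist _ (f b) (inN b)); split=> //; last exact: val_inj.
apply: inj_card_bij => //.
by rewrite card_sig -cardsT -(card_imset _ injf) -nf leqnn.
Qed.

Lemma iso_ball_emb (B : rooted) (V : finType) (G : graph V) (v : V) :
  rooted_iso B (nbhd_ball G r v) -> exists f : bvertex B -> V, ball_emb G v f.
Proof.
case=> f [[g fK gK] ef cf]; exists (fun b => val (f b)); split.
- by move=> x y /val_inj; apply: can_inj fK _ _.
- by move=> x y; rewrite -ef.
- by rewrite cf.
apply/setP => w; apply/idP/imsetP => [wN|[b _ ->]]; last exact: valP.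
by exists (g (exist _ w wN)); rewrite ?gK.
Qed.

Lemma rtype_rep : exists2 B, tau B &
  forall (V : finType) (G : graph V) v,
    has_type tau G v <-> exists f : bvertex B -> V, ball_emb G v f.
Proof.
have [B ballB tauP] := rtype_class tau.
exists B => [|V G v].
  apply/tauP; split=> //; exists id; split=> //.
  exact: (Bijective (g := id)).
split=> [/tauP[_]|[f /ball_emb_iso Bv]]; first exact: iso_ball_emb.
by apply/tauP; split=> //; apply: is_ball_nbhd_ball.
Qed.

Lemma has_type_ball_map (U V : finType) (Q : graph U) (H : graph V) g q :
  injective g -> nbhd H r (g q) = g @: nbhd Q r q ->
  {in nbhd Q r q &, forall x y, edge H (g x) (g y) = edge Q x y} ->
  has_type tau H (g q) <-> has_type tau Q q.
Proof.
have [B _ tauP] := rtype_rep => injg nbhdH gE; split=> /tauP[f [injf ef cf nf]].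
  have preim b : exists j, (j \in nbhd Q r q) && (f b == g j).
    have /imsetP[j jN ->] : f b \in g @: nbhd Q r q.
      by rewrite -nbhdH nf imset_f.
    by exists j; rewrite jN eqxx.
  pose h b := xchoose (preim b).
  have hN b : h b \in nbhd Q r q by case/andP: (xchooseP (preim b)).
  have hK b : f b = g (h b) by case/andP: (xchooseP (preim b)) => _ /eqP.
  apply/tauP; exists h; split=> [x y hxy|x y||].
  - by apply: injf; rewrite !hK hxy.
  - by rewrite -ef !hK gE.
  - by apply: injg; rewrite -hK.
  - apply: (imset_inj injg); rewrite -nbhdH nf -imset_comp.
    by apply: eq_imset => b /=; rewrite hK.
have fN b : f b \in nbhd Q r q by rewrite nf imset_f.
apply/tauP; exists (g \o f); split=> [|x y||].
- exact: inj_comp.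
- by rewrite /= gE.
- by rewrite /= cf.
- by rewrite nbhdH nf -imset_comp.
Qed.

Definition type_set (V : finType) (G : graph V) : {set V} :=
  [set v | `[< has_type tau G v >]].

Lemma type_setP (V : finType) (G : graph V) v :
  reflect (has_type tau G v) (v \in type_set G).
Proof. by rewrite inE; apply: asboolP. Qed.

Lemma nbhd_free_type_set n (G : graph 'I_n) :
  nbhd_free tau G <-> type_set G = set0.
Proof.
split=> [freeG|noG v /type_setP]; last by rewrite noG inE.
by apply/setP => v; rewrite in_set0; apply/type_setP/freeG.
Qed.

Variable d' : nat.
Hypothesis r_gt0 : 0 < r.
Hypothesis degree_tau : rtype_degree_le tau d'.

Lemma has_type_deg (V : finType) (G : graph V) z w :
  has_type tau G z -> dist_le G r.-1 z w -> deg G w <= d'.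
Proof.
have [B tauB tauP] := rtype_rep => /tauP[f [injf ef cf nf]] zw.
have /imsetP[b _ wE] : w \in [set f b | b in [set: bvertex B]].
  by rewrite -nf inE; apply: dist_leW zw; apply: leq_pred.
apply: leq_trans (deg_leq b (degree_tau tauB)).
rewrite /deg -(card_imset _ injf); apply: subset_leq_card; apply/subsetP => y.
rewrite in_neighbours => wy.
have /imsetP[c _ yE] : y \in [set f b | b in [set: bvertex B]].
  rewrite -nf inE -(prednK r_gt0); apply/dist_leSP; exists w => //.
  by rewrite wy orbT.
by rewrite yE imset_f // in_neighbours -ef -wE -yE.
Qed.

Lemma type_set_deg (V : finType) (G : graph V) z :
  d' < deg G z -> z \notin type_set G.
Proof.
move=> dz; apply/type_setP => tz; move: dz.
by rewrite ltnNge (has_type_deg tz (dist_le_refl _ _ _)).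
Qed.

End Types.

(* As D has large degrees in H, a vertex of type tau in H can see D only at
   distance exactly r, where the last two hypotheses forbid a change of its
   ball. *)
Section Surgery.
Variables (r d' : nat) (tau : rtype r).
Hypothesis r_gt0 : 0 < r.
Hypothesis degree_tau : rtype_degree_le tau d'.

Variables (V : finType) (G H : graph V) (D X : {set V}).
Hypothesis agreeGH : agree_off D G H.
Hypothesis degH : forall x, x \in D -> x \notin X -> d' < deg H x.
Hypothesis closedX : closed (edge H) X.
Hypothesis deletions : forall x y, edge G x y -> ~~ edge H x y ->
  (neighbours G x \subset D) || (neighbours G y \subset D).
Hypothesis insertions : forall x y, edge H x y -> ~~ edge G x y ->
  x \notin X -> y \notin X -> ~~ dist_le G (r + r) x y.

Section TypedVertex.
Variable z : V.
Hypothesis zX : z \notin X.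
Hypothesis tauHz : has_type tau H z.

Lemma dist_le_notin_closed k w : dist_le H k z w -> w \notin X.
Proof. by move=> /(closed_dist_le closedX) <-. Qed.

Lemma dist_le_pred_notin w : dist_le H r.-1 z w -> w \notin D.
Proof.
move=> zw; apply/negP => wD.
have := has_type_deg r_gt0 degree_tau tauHz zw.
by rewrite leqNgt degH // (dist_le_notin_closed zw).
Qed.

Lemma surgery_dist_le k w : k <= r -> dist_le G k z w = dist_le H k z w.
Proof.
elim: k w => [|k IHk] w kr; first by rewrite !dist_le0.
have distE y : dist_le G k z y = dist_le H k z y by apply: IHk; apply: ltnW.
have edgeE y : dist_le H k z y -> edge G y w = edge H y w.
  move=> zy; apply: agreeGH; apply: dist_le_pred_notin.
  by apply: dist_leW zy; rewrite -ltnS prednK.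
apply/dist_leSP/dist_leSP => -[y zy yw]; exists y; rewrite ?distE // -?distE //.
  by rewrite -edgeE // -distE.
by rewrite edgeE.
Qed.

Lemma neighbours_notin_ball x :
  neighbours G x \subset D -> x \in D -> ~~ dist_le G r z x.
Proof.
move=> /subsetP xD Dx; apply/negP; rewrite -(prednK r_gt0) => /dist_leSP[y].
rewrite surgery_dist_le ?leq_pred // => /dist_le_pred_notin yD.
case/orP => [/eqP yx|yx]; first by rewrite yx Dx in yD.
by case/negP: yD; apply: xD; rewrite in_neighbours edge_sym.
Qed.

Lemma surgery_edge x y :
  dist_le G r z x -> dist_le G r z y -> edge G x y = edge H x y.
Proof.
move=> zx zy; apply/eqP; apply: contraT => neq.
have /andP[xD yD] := agree_off_mem agreeGH neq.
move: neq; case: (boolP (edge G x y)) => [Gxy|nGxy];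
  case: (boolP (edge H x y)) => //.
  move=> nHxy _; case/orP: (deletions Gxy nHxy) => /neighbours_notin_ball.
    by move/(_ xD)/negP.
  by move/(_ yD)/negP.
move=> Hxy _; have zHx := zx; have zHy := zy.
rewrite surgery_dist_le // in zHx; rewrite surgery_dist_le // in zHy.
have xX := dist_le_notin_closed zHx; have yX := dist_le_notin_closed zHy.
case/negP: (insertions Hxy nGxy xX yX).
by apply: dist_leD zy; rewrite dist_le_sym.
Qed.

Lemma has_type_surgery : has_type tau G z.
Proof.
apply/(@has_type_ball_map _ tau _ _ G H id z) => //.
  by rewrite imset_id; apply/setP => w; rewrite !inE surgery_dist_le.
by move=> x y; rewrite !inE => zx zy; rewrite surgery_edge.
Qed.

End TypedVertex.

Lemma type_set_surgery : type_set tau H \subset type_set tau G :|: X.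
Proof.
apply/subsetP => z /type_setP tz; rewrite in_setU.
have [_|zX] := boolP (z \in X); first by rewrite orbT.
by rewrite orbF; apply/type_setP; apply: has_type_surgery tz.
Qed.

End Surgery.

(** * Components and regular graphs *)

Definition component_emb (U V : finType) (Q : graph U) (H : graph V)
    (g : U -> V) : Prop :=
  injective g /\ forall i, neighbours H (g i) = g @: neighbours Q i.

Lemma component_emb_comp (U V W : finType) (P : graph U) (Q : graph V)
    (H : graph W) f g :
  component_emb P Q f -> component_emb Q H g -> component_emb P H (g \o f).
Proof.
move=> [injf fP] [injg gQ]; split=> [|i]; first exact: inj_comp.
by rewrite /= gQ fP imset_comp.
Qed.

Section ComponentEmb.
Variables (U V : finType) (Q : graph U) (H : graph V) (g : U -> V).
Hypothesis gQ : component_emb Q H g.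

Lemma edge_component i j : edge H (g i) (g j) = edge Q i j.
Proof. by have [injg gN] := gQ; rewrite -in_neighbours gN mem_imset // inE. Qed.

Lemma deg_component i : deg H (g i) = deg Q i.
Proof. by have [injg gN] := gQ; rewrite /deg gN card_imset. Qed.

Lemma closed_component : closed (edge H) (g @: [set: U]).
Proof.
apply: intro_closed => [|x y xy /imsetP[i _ xE]].
  exact: sym_connect_sym (edge_sym H).
have : y \in neighbours H (g i) by rewrite in_neighbours -xE.
by rewrite gQ.2 => /imsetP[j _ ->]; rewrite imset_f.
Qed.

Lemma nbhd_component k q : nbhd H k (g q) = g @: nbhd Q k q.
Proof.
have [injg gN] := gQ; elim: k => [|k IHk]; first by rewrite !nbhd0 imset_set1.
rewrite !nbhdS IHk big_imset /=; last by move=> i j _ _ /injg.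
rewrite (big_morph _ (imsetU g) (imset0 g)); apply: eq_bigr => i _.
by rewrite imsetU1 gN.
Qed.

Lemma has_type_component r (tau : rtype r) q :
  has_type tau H (g q) <-> has_type tau Q q.
Proof.
apply: has_type_ball_map => [||x y _ _]; first by case: gQ.
  exact: nbhd_component.
exact: edge_component.
Qed.

End ComponentEmb.

Section EmptyGraph.
Variable V : finType.

Definition empty_graph : graph V :=
  @Graph V (fun _ _ => false) (fun _ _ => erefl) (fun _ => erefl).

Lemma deg_empty_graph v : deg empty_graph v = 0.
Proof. by apply: eq_card0 => w; rewrite in_neighbours. Qed.

End EmptyGraph.

Section GraphSum.
Variables (U W : finType) (A : graph U) (B : graph W).

Definition sum_edge (x y : U + W) : bool :=
  match x, y with
  | inl i, inl j => edge A i j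
  | inr i, inr j => edge B i j
  | _, _ => false
  end.

Lemma sum_edge_sym : symmetric sum_edge.
Proof. by move=> [i|i] [j|j] //=; apply: edge_sym. Qed.

Lemma sum_edge_irr : irreflexive sum_edge.
Proof. by move=> [i|i] /=; apply: edge_irr. Qed.

Definition graph_sum : graph (U + W)%type := Graph sum_edge_sym sum_edge_irr.

Lemma component_emb_inl : component_emb A graph_sum inl.
Proof.
split=> [i j []//|i]; apply/setP => y; rewrite inE.
apply/idP/imsetP => [|[j]]; last by rewrite inE => ij ->.
by case: y => // j ij; exists j; rewrite // inE.
Qed.

Lemma component_emb_inr : component_emb B graph_sum inr.
Proof.
split=> [i j []//|i]; apply/setP => y; rewrite inE.
apply/idP/imsetP => [|[j]]; last by rewrite inE => ij ->.
by case: y => // j ij; exists j; rewrite // inE.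
Qed.

Lemma max_degree_graph_sum d :
  max_degree A <= d -> max_degree B <= d -> max_degree graph_sum <= d.
Proof.
move=> /max_degreeP dA /max_degreeP dB; apply/max_degreeP => -[i|i].
  by rewrite (deg_component component_emb_inl).
by rewrite (deg_component component_emb_inr).
Qed.

End GraphSum.

Section CompleteBipartite.
Variable T : finType.

Definition bipartite_edge (x y : bool * T) : bool := x.1 != y.1.

Lemma bipartite_edge_sym : symmetric bipartite_edge.
Proof. by move=> x y; rewrite /bipartite_edge eq_sym. Qed.

Lemma bipartite_edge_irr : irreflexive bipartite_edge.
Proof. by move=> x; rewrite /bipartite_edge eqxx. Qed.

Definition complete_bipartite : graph (bool * T)%type :=
  Graph bipartite_edge_sym bipartite_edge_irr.

Lemma deg_complete_bipartite x : deg complete_bipartite x = #|T|.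
Proof.
rewrite -[RHS](@card_imset _ _ (pair (~~ x.1)) T); last by move=> i j [].
apply: eq_card => -[b i]; rewrite in_neighbours /=.
rewrite /bipartite_edge /=; apply/idP/imsetP => [xb|[j _ [-> _]]].
  by exists i => //; case: x.1 b xb => -[].
by case: x.1.
Qed.

End CompleteBipartite.

Section SumGraph.
Local Open Scope ring_scope.
Variables (A : finZmodType) (S : {set A}).
Hypothesis double_notin : forall i, i + i \notin S.

Lemma add_in_sym : symmetric (fun i j => i + j \in S).
Proof. by move=> i j; rewrite addrC. Qed.

Lemma add_in_irr : irreflexive (fun i j => i + j \in S).
Proof. by move=> i; apply/negbTE. Qed.

Definition sum_graph : graph A := Graph add_in_sym add_in_irr.

Lemma deg_sum_graph i : deg sum_graph i = #|S|.
Proof.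
rewrite -[RHS](card_preimset _ (addrI i)).
by apply: eq_card => j; rewrite !inE.
Qed.

End SumGraph.

Section Pullback.
Variables (U V : finType) (f : U -> V) (G : graph V).

Definition pullback : graph U :=
  @Graph U (fun i j => edge G (f i) (f j)) (fun _ _ => edge_sym G _ _)
    (fun _ => edge_irr G _).

Lemma deg_pullback i : bijective f -> deg pullback i = deg G (f i).
Proof.
move=> bijf; rewrite /deg -(@on_card_preimset _ _ f); last exact: onW_bij.
by apply: eq_card => j; rewrite !inE.
Qed.

End Pullback.

(* On Z/n with n even, i + i never is one of the k odd residues
   1, 3, ..., 2k - 1. *)
Lemma ex_regular_graph_ord n k :
  odd n -> k.*2 <= n.+1 -> exists G : graph 'I_n.+1, forall i, deg G i = k.
Proof.
move=> odd_n kn; pose o (i : 'I_k) : 'I_n.+1 := inord i.*2.+1.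
have oE i : o i = i.*2.+1 :> nat by rewrite inordK //; have := ltn_ord i; lia.
have double_notin (i : 'I_n.+1) : (i + i)%R \notin [set o j | j : 'I_k].
  apply/imsetP => -[j _ /(congr1 (fun x : 'I__ => odd x))].
  by rewrite oE /= odd_mod ?addnn ?odd_double //= odd_n.
exists (sum_graph double_notin) => i.
rewrite deg_sum_graph card_imset ?card_ord // => j1 j2 /(congr1 val) /=.
by rewrite !oE => -[/double_inj/val_inj].
Qed.

Lemma ex_regular_graph (U : finType) k :
  ~~ odd #|U| -> k.*2 <= #|U| -> exists G : graph U, forall i, deg G i = k.
Proof.
case Un : #|U| => [|n] even_n kn.
  by exists (empty_graph U) => i; have := fintype0 i Un.
have [|G dG] := @ex_regular_graph_ord n k _ kn; first by rewrite -[odd n]negbK.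
pose f (i : U) := cast_ord Un (enum_rank i).
have bijf : bijective f.
  by apply: inj_card_bij => [i j /cast_ord_inj/enum_rank_inj//|];
    rewrite card_ord Un.
by exists (pullback f G) => i; rewrite deg_pullback.
Qed.

(** * Rerouting a matching *)

(* The edge from [f i] to [f (mu i)] is replaced by the edges from [f i] to
   [stub i] and from [f (mu i)] to [stub (mu i)]: the degrees of the [f i] stay
   the same, and those of the [stub i] grow. *)
Section Reroute.
Variables (V T : finType) (G : graph V) (K : {set V}).
Variables (mu : T -> T) (f stub : T -> V).
Hypothesis muK : involutive mu.
Hypothesis injf : injective f.
Hypothesis matching : forall i, edge G (f i) (f (mu i)).
Hypothesis closedK : closed (edge G) K.
Hypothesis fK : forall i, f i \in K.
Hypothesis stubK : forall i, stub i \notin K.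

Definition matched (x y : V) : bool :=
  [exists i, (x == f i) && (y == f (mu i))].

Definition attached (x y : V) : bool := [exists i, (x == f i) && (y == stub i)].

Definition reroute_edge (x y : V) : bool :=
  [|| edge G x y && ~~ matched x y, attached x y | attached y x].

Lemma matched_sym : symmetric matched.
Proof.
apply: symmetric_from_pre => x y /existsP[i /andP[/eqP-> /eqP->]].
by apply/existsP; exists (mu i); rewrite muK !eqxx.
Qed.

Lemma attached_mem x y : attached x y -> (x \in K) && (y \notin K).
Proof. by case/existsP => i /andP[/eqP-> /eqP->]; rewrite fK stubK. Qed.

Lemma reroute_edge_sym : symmetric reroute_edge.
Proof.
by move=> x y; rewrite /reroute_edge edge_sym matched_sym
  [attached x y || _]orbC.
Qed.

Lemma reroute_edge_irr : irreflexive reroute_edge.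
Proof.
move=> x; rewrite /reroute_edge edge_irr orbb /=.
by apply/negbTE/negP => /attached_mem/andP[->].
Qed.

Definition reroute : graph V := Graph reroute_edge_sym reroute_edge_irr.

Lemma matchedE i y : matched (f i) y = (y == f (mu i)).
Proof.
apply/existsP/eqP => [[j /andP[/eqP/injf<- /eqP]]//|->].
by exists i; rewrite !eqxx.
Qed.

Lemma attachedE i y : attached (f i) y = (y == stub i).
Proof.
apply/existsP/eqP => [[j /andP[/eqP/injf<- /eqP]]//|->].
by exists i; rewrite !eqxx.
Qed.

Lemma matched_out x y : x \notin f @: [set: T] -> matched x y = false.
Proof. by apply: contraNF => /existsP[i /andP[/eqP-> _]]; rewrite imset_f. Qed.

Lemma attached_out x y : x \notin f @: [set: T] -> attached x y = false.
Proof. by apply: contraNF => /existsP[i /andP[/eqP-> _]]; rewrite imset_f. Qed.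

Lemma edge_closedK x y : x \in K -> edge G x y -> y \in K.
Proof. by move=> xK /closedK <-. Qed.

Lemma neighbours_reroute_matched i :
  neighbours reroute (f i) = stub i |: (neighbours G (f i) :\ f (mu i)).
Proof.
apply/setP => y; rewrite !inE /= /reroute_edge matchedE attachedE.
have -> : attached y (f i) = false.
  by apply/negbTE/negP => /attached_mem; rewrite fK andbF.
by rewrite orbF orbC andbC.
Qed.

Lemma deg_reroute_matched i : deg reroute (f i) = deg G (f i).
Proof.
rewrite /deg neighbours_reroute_matched cardsU1 !inE.
rewrite (contraNF (edge_closedK (fK i)) (stubK i)) andbF.
by rewrite [RHS](cardsD1 (f (mu i))) in_neighbours matching.
Qed.

Lemma neighbours_reroute x : x \notin f @: [set: T] ->
  neighbours reroute x = neighbours G x :|: f @: [set i | stub i == x].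
Proof.
move=> xf; apply/setP => y; rewrite !inE /= /reroute_edge.
rewrite matched_out // attached_out // andbT /=; congr (_ || _).
apply/existsP/imsetP => -[i].
  by case/andP => yE xE; exists i; [rewrite inE eq_sym|apply/eqP].
by rewrite inE => xE yE; exists i; rewrite yE eqxx eq_sym.
Qed.

Lemma deg_reroute x : x \notin f @: [set: T] ->
  deg reroute x = deg G x + #|[set i | stub i == x]|.
Proof.
move=> xf; rewrite /deg neighbours_reroute // cardsU (card_imset _ injf).
rewrite [X in _ - X](_ : _ = 0) ?subn0 //; apply/eqP; rewrite cards_eq0.
apply/eqP/setP => y; rewrite !inE; apply/andP => -[xy /imsetP[i]].
rewrite inE => /eqP iE yE; have := stubK i.
by rewrite iE (closedK xy) yE fK.
Qed.

Lemma leq_deg_reroute x : deg G x <= deg reroute x.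
Proof.
have [/imsetP[i _ ->]|xf] := boolP (x \in f @: [set: T]).
  by rewrite deg_reroute_matched.
by rewrite deg_reroute // leq_addr.
Qed.

Lemma agree_off_reroute : agree_off (K :|: stub @: [set: T]) G reroute.
Proof.
move=> x; rewrite in_setU negb_or => /andP[xK xstub] y.
have xf : x \notin f @: [set: T] by apply: contra xK => /imsetP[i _ ->].
rewrite /= /reroute_edge matched_out // attached_out // andbT orFb.
have -> : attached y x = false; last by rewrite orbF.
by apply: contraNF xstub => /existsP[i /andP[_ /eqP->]]; rewrite imset_f.
Qed.

Lemma max_degree_reroute d :
  max_degree G <= d -> (forall i, deg reroute (stub i) <= d) ->
  max_degree reroute <= d.
Proof.
move=> /max_degreeP dG dstub; apply/max_degreeP => x.
have [/imsetP[i _ ->]|xf] := boolP (x \in f @: [set: T]).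
  by rewrite deg_reroute_matched.
have [/existsP[i /eqP<-]|nostub] := boolP [exists i, stub i == x].
  exact: dstub.
rewrite deg_reroute // (_ : [set i | _] = set0) ?cards0 ?addn0 //.
apply/setP => i; rewrite !inE.
by move: nostub; rewrite negb_exists => /forallP/(_ i)/negbTE.
Qed.

Lemma edit_dist_reroute : edit_dist G reroute <= (#|K| + #|T|) ^ 2.
Proof.
apply: leq_trans (agree_off_edit_dist agree_off_reroute) _.
rewrite leq_exp2r //.
apply: leq_trans (leq_card_setU _ _) _; rewrite leq_add2l.
by apply: leq_trans (leq_imset_card _ _) _; rewrite cardsT.
Qed.

Lemma type_set_reroute r d' (tau : rtype r) : 0 < r ->
  rtype_degree_le tau d' ->
  (forall x, x \in K -> d' < deg G x) ->
  (forall i, d' < deg reroute (stub i)) ->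
  type_set tau reroute \subset type_set tau G.
Proof.
move=> r_gt0 degtau degK degstub; rewrite -[type_set tau G]setU0.
apply: (type_set_surgery r_gt0 degtau agree_off_reroute) => [x|x y|x y xy|x y].
- case/setUP => [/degK dx _|/imsetP[i _ ->] _]; last exact: degstub.
  exact: leq_trans dx (leq_deg_reroute x).
- by rewrite !inE.
- rewrite /= /reroute_edge xy negb_or /= negbK.
  case/andP => /existsP[i /andP[/eqP xE _]] _.
  apply/orP; left; apply/subsetP => w; rewrite in_neighbours => xw.
  by rewrite in_setU (edge_closedK _ xw) // xE.
- have far v w : attached v w -> ~~ dist_le G (r + r) v w.
    move=> /attached_mem/andP[vK]; apply: contra.
    by move=> /(closed_dist_le closedK) <-.
  rewrite /= /reroute_edge => /or3P[/andP[->]//|xy|yx] _ _ _; first exact: far.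
  by rewrite dist_le_sym far.
Qed.

End Reroute.

Lemma ex_fun_count_mem (T : finType) (V : eqType) (s : seq V) : size s = #|T| ->
  exists h : T -> V, forall x, #|[set t | h t == x]| = count_mem x s.
Proof.
move=> sT; pose phi (t : T) := cast_ord (esym sT) (enum_rank t).
exists (fun t => tnth (in_tuple s) (phi t)) => x.
have bij_phi : bijective phi.
  by apply: inj_card_bij => [t u /cast_ord_inj/enum_rank_inj//|];
    rewrite card_ord sT.
rewrite -sum1_count big_tnth -sum1_card (reindex phi) /=; last exact: onW_bij.
by apply: eq_bigl => t; rewrite inE.
Qed.

Lemma ex_fun_card_fibre (T V : finType) (F : V -> nat) : #|T| = \sum_x F x ->
  exists h : T -> V, forall x, #|[set t | h t == x]| = F x.
Proof.
move=> TF; pose s := flatten [seq nseq (F y) y | y <- enum V].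
have [|h hP] := @ex_fun_count_mem T V s.
  rewrite TF size_flatten /shape -map_comp sumnE big_map enumT.
  by apply: eq_bigr => y _; rewrite /= size_nseq.
exists h => x; rewrite hP count_flatten -map_comp sumnE big_map enumT.
rewrite (bigD1 x) //= count_nseq /= eqxx mul1n big1 ?addn0 // => y yx.
by rewrite count_nseq /= (negbTE yx).
Qed.

Definition is_repair d r (tau : rtype r) c (V : finType) (G H : graph V)
    (S : {set V}) : Prop :=
  [/\ max_degree H <= d, edit_dist G H <= c &
      type_set tau H \subset type_set tau G :\: S].

Lemma repairW d r (tau : rtype r) c c' (V : finType) (G H : graph V)
    (S S' : {set V}) :
  c <= c' -> S' \subset S ->
  is_repair d tau c G H S -> is_repair d tau c' G H S'.
Proof.
move=> le_c sub_S [dH eH tH]; split=> //; first exact: leq_trans eH le_c.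
exact: subset_trans tH (setDS _ sub_S).
Qed.

Section Saturate.
Variables (r d' d : nat) (tau : rtype r).
Hypothesis r_gt0 : 0 < r.
Hypothesis d'_lt_d : d' < d.
Hypothesis degree_tau : rtype_degree_le tau d'.

Variables (V : finType) (G : graph V) (f : bool * 'I_d -> V) (S : {set V}).
Hypothesis max_degree_G : max_degree G <= d.
Hypothesis fG : component_emb (complete_bipartite 'I_d) G f.
Hypothesis disjoint_S : [disjoint S & f @: [set: bool * 'I_d]].
Local Notation deficiency := (\sum_(x in S) (d - deg G x)).
Local Notation npairs := (deficiency./2).
Hypothesis even_deficiency : ~~ odd deficiency.
Hypothesis deficiency_le : deficiency <= d.*2.

Lemma ex_stub : exists stub : bool * 'I_npairs -> V,
  (forall t, stub t \in S) /\
  forall x, x \in S -> #|[set t | stub t == x]| = d - deg G x.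
Proof.
have [|stub stubP] := @ex_fun_card_fibre (bool * 'I_npairs)%type V
    (fun x => if x \in S then d - deg G x else 0).
  by rewrite -big_mkcond card_prod card_bool card_ord mul2n even_halfK.
exists stub; split=> [t|x xS]; last by rewrite stubP xS.
apply: contraT => tS; have := stubP (stub t).
by rewrite (negbTE tS) => /card0_eq/(_ t); rewrite !inE eqxx.
Qed.

Lemma ex_saturation : exists H, is_repair d tau ((4 * d) ^ 2) G H S.
Proof.
have [stub [stubS stub_fibre]] := ex_stub; have [injf _] := fG.
have npairs_le : npairs <= d by rewrite leq_half_double; apply: leqW.
pose K := f @: [set: bool * 'I_d].
pose mu (t : bool * 'I_npairs) := (~~ t.1, t.2).
pose g (t : bool * 'I_npairs) := f (t.1, widen_ord npairs_le t.2).
have SK x : x \in S -> x \notin K by move=> /(disjointFr disjoint_S) ->.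
have muK : involutive mu by case=> b i; rewrite /mu negbK.
have injg : injective g.
  by case=> [b i] [c j] /injf[-> ij]; congr (_, _); apply: val_inj.
have gmu t : edge G (g t) (g (mu t)).
  by rewrite /g (edge_component fG); case: t => -[] i.
have gK t : g t \in K by apply: imset_f.
have clK : closed (edge G) K := closed_component fG.
have stubK t := SK _ (stubS t).
pose H := reroute G muK gK stubK.
have degS x : x \in S -> deg H x = d.
  move=> xS; rewrite deg_reroute ?stub_fibre ?subnKC ?deg_leq //.
  by apply: contra (SK x xS) => /imsetP[t _ ->].
exists H; split.
- by apply: max_degree_reroute => // t; rewrite degS.
- apply: leq_trans (edit_dist_reroute _ _ _ _) _; rewrite leq_exp2r //.
  rewrite card_imset // cardsT !card_prod card_bool !card_ord; lia.
rewrite subsetD; apply/andP; split.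
  apply: (type_set_reroute injg gmu clK r_gt0 degree_tau) => // [x|t].
    case/imsetP => i _ ->.
    by rewrite (deg_component fG) deg_complete_bipartite card_ord.
  by rewrite degS.
rewrite disjoint_sym; apply/pred0P => x /=; apply/negbTE/negP => /andP[xS].
by apply/negP/(type_set_deg r_gt0 degree_tau); rewrite degS.
Qed.

End Saturate.

(** * Inserting a component *)

(* The pairwise distant vertices [g i] are cut off and carry a copy of Q. Their
   former neighbours [nbr i a] in a given position a are joined by a copy of the
   graph [link a], which is regular and makes their degrees equal to d. *)
Section Insertion.
Variables (V U A : finType) (G : graph V) (Q : graph U) (link : A -> graph U).
Variables (g : U -> V) (nbr : U -> A -> V) (d rho : nat).
Hypothesis rho_gt0 : 0 < rho.
Hypothesis far_g : forall i j, i != j -> ~~ dist_le G rho.+2 (g i) (g j).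
Hypothesis neighbours_g : forall i, neighbours G (g i) = nbr i @: [set: A].
Hypothesis nbr_inj : forall i, injective (nbr i).
Hypothesis deg_link : forall a i, deg (link a) i = (d - deg G (nbr i a)).+1.
Hypothesis max_degree_G : max_degree G <= d.

Local Notation X := (g @: [set: U]).
Local Notation ports := ((fun p => nbr p.1 p.2) @: [set: U * A]).

Lemma near_g_eq i j x y : dist_le G 1 (g i) x -> dist_le G rho x y ->
  dist_le G 1 (g j) y -> i = j.
Proof.
move=> ix xy jy; apply/eqP; apply: contraT => /far_g/negP; case.
rewrite -[rho.+2]addn1 -add1n -addnA; apply: dist_leD ix (dist_leD xy _).
by rewrite dist_le_sym.
Qed.

Lemma near_g_uniq i j x : dist_le G 1 (g i) x -> dist_le G 1 (g j) x -> i = j.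
Proof. by move=> ix; apply: near_g_eq ix (dist_le_refl _ _ _). Qed.

Lemma g_inj : injective g.
Proof.
by move=> i j gij; apply: (near_g_uniq (x := g i)); rewrite ?gij dist_le_refl.
Qed.

Lemma edge_nbr i a : edge G (g i) (nbr i a).
Proof. by rewrite -in_neighbours neighbours_g imset_f. Qed.

Lemma dist_le_nbr i a : dist_le G 1 (g i) (nbr i a).
Proof. exact/dist_le_edge/edge_nbr. Qed.

Lemma nbr_near_eq i j a b : dist_le G rho (nbr i a) (nbr j b) -> i = j.
Proof.
by move=> ij; apply: near_g_eq (dist_le_nbr i a) ij (dist_le_nbr j b).
Qed.

Lemma nbr_eq i j a b : nbr i a = nbr j b -> i = j /\ a = b.
Proof.
move=> E; have ij : i = j.
  by apply: (@nbr_near_eq _ _ a b); rewrite E dist_le_refl.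
by split=> //; rewrite -ij in E; apply: nbr_inj E.
Qed.

Lemma edge_nbr_g i a j : edge G (nbr i a) (g j) = (i == j).
Proof.
rewrite edge_sym; apply/idP/eqP => [ja|<-]; last exact: edge_nbr.
exact: near_g_uniq (dist_le_nbr i a) (dist_le_edge ja).
Qed.

Lemma nbr_notin i a : nbr i a \notin X.
Proof.
apply/imsetP => -[j _ E]; have := edge_nbr_g i a i.
rewrite eqxx E => /dist_le_edge/near_g_uniq/(_ (dist_le_refl _ _ _)) ji.
by have := edge_nbr i a; rewrite E ji edge_irr.
Qed.

Definition placed (x y : V) : bool :=
  [exists i, exists j, [&& x == g i, y == g j & edge Q i j]].

Definition linked (x y : V) : bool :=
  [exists a, exists i, exists j,
    [&& x == nbr i a, y == nbr j a & edge (link a) i j]].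

Definition insert_edge (x y : V) : bool :=
  [|| placed x y, linked x y | [&& x \notin X, y \notin X & edge G x y]].

Lemma placed_sym : symmetric placed.
Proof.
apply: symmetric_from_pre => x y /existsP[i /existsP[j /and3P[xi yj ij]]].
by apply/existsP; exists j; apply/existsP; exists i; rewrite xi yj edge_sym.
Qed.

Lemma linked_sym : symmetric linked.
Proof.
apply: symmetric_from_pre => x y.
case/existsP => a /existsP[i /existsP[j /and3P[xi yj ij]]].
apply/existsP; exists a; apply/existsP; exists j; apply/existsP; exists i.
by rewrite xi yj edge_sym.
Qed.

Lemma placed_mem x y : placed x y -> (x \in X) && (y \in X).
Proof.
by case/existsP => i /existsP[j /and3P[/eqP-> /eqP-> _]]; rewrite !imset_f.
Qed.

Lemma linked_notin x y : linked x y -> (x \notin X) && (y \notin X).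
Proof.
by case/existsP => a /existsP[i /existsP[j /and3P[/eqP-> /eqP-> _]]];
  rewrite !nbr_notin.
Qed.

Lemma placedE i y : placed (g i) y = (y \in g @: neighbours Q i).
Proof.
apply/existsP/imsetP => [[i' /existsP[j /and3P[/eqP/g_inj<- /eqP-> ij]]]|[j]].
  by exists j; rewrite // in_neighbours.
by rewrite in_neighbours => ij ->; exists i; apply/existsP; exists j;
  rewrite !eqxx.
Qed.

Lemma linkedE i a y :
  linked (nbr i a) y = (y \in nbr^~ a @: neighbours (link a) i).
Proof.
apply/existsP/imsetP => [[b /existsP[i' /existsP[j]]]|[j]].
  by case/and3P => /eqP/nbr_eq[<- <-] /eqP-> ij; exists j;
    rewrite // in_neighbours.
rewrite in_neighbours => ij ->; exists a.
by apply/existsP; exists i; apply/existsP; exists j; rewrite !eqxx.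
Qed.

Lemma insert_edge_sym : symmetric insert_edge.
Proof.
by move=> x y; rewrite /insert_edge placed_sym linked_sym edge_sym
  [in LHS]andbCA.
Qed.

Lemma insert_edge_irr : irreflexive insert_edge.
Proof.
move=> x; apply/negbTE/negP => /or3P[/existsP[i]|/existsP[a]|/and3P[_ _]].
- by case/existsP => j /and3P[/eqP-> /eqP/g_inj<-]; rewrite edge_irr.
- by case/existsP => i /existsP[j /and3P[/eqP-> /eqP/nbr_eq[<- _]]];
    rewrite edge_irr.
- by rewrite edge_irr.
Qed.

Definition insert : graph V := Graph insert_edge_sym insert_edge_irr.

Lemma insert_edge_outside x y : x \notin X -> y \notin X ->
  edge insert x y = linked x y || edge G x y.
Proof.
move=> xX yX; rewrite /= /insert_edge xX yX /=.
by have -> : placed x y = false by apply: contraNF xX => /placed_mem/andP[].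
Qed.

Lemma component_emb_insert : component_emb Q insert g.
Proof.
split=> [|i]; first exact: g_inj.
apply/setP => y; rewrite in_neighbours /= /insert_edge placedE imset_f //= orbF.
have -> : linked (g i) y = false; last by rewrite orbF.
by apply/negbTE/negP => /linked_notin; rewrite imset_f.
Qed.

Lemma neighbours_insert_nbr i a : neighbours insert (nbr i a) =
  (neighbours G (nbr i a) :\ g i) :|: nbr^~ a @: neighbours (link a) i.
Proof.
apply/setP => y; rewrite in_neighbours in_setU in_setD1 in_neighbours -linkedE.
have [/imsetP[j _ ->]|yX] := boolP (y \in X).
  rewrite /= /insert_edge imset_f // andbF orbF edge_nbr_g.
  rewrite eq_sym (inj_eq g_inj) andNb; congr (_ || _).
  apply/negbTE/negP => /placed_mem.
  by rewrite (negbTE (nbr_notin i a)).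
rewrite insert_edge_outside ?nbr_notin // orbC; congr (_ || _).
by have -> : y != g i by apply: contra yX => /eqP->; rewrite imset_f.
Qed.

Lemma deg_insert_nbr i a : deg insert (nbr i a) = d.
Proof.
have injnbr : injective (nbr^~ a) by move=> j k /nbr_eq[].
rewrite /deg neighbours_insert_nbr cardsU (card_imset _ injnbr).
rewrite [X in _ - X](_ : _ = 0) ?subn0; last first.
  apply/eqP; rewrite cards_eq0; apply/eqP/setP => y; rewrite !inE.
  apply/negbTE/negP => /andP[/andP[_ /dist_le_edge iy] /imsetP[j]].
  rewrite in_neighbours => ij yE; rewrite yE in iy.
  by move: ij; rewrite (nbr_near_eq (dist_leW rho_gt0 iy)) edge_irr.
have := deg_leq (nbr i a) max_degree_G; have := deg_link a i.
rewrite /deg (cardsD1 (g i) (neighbours G _)) in_neighbours edge_nbr_g eqxx.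
by lia.
Qed.

Lemma agree_off_insert : agree_off (X :|: ports) G insert.
Proof.
move=> x; rewrite in_setU negb_or => /andP[xX xports] y.
have nlinked : linked x y = false.
  apply: contraNF xports.
  case/existsP => a /existsP[i /existsP[j /and3P[/eqP-> _ _]]].
  by apply/imsetP; exists (i, a).
have [/imsetP[j _ ->]|yX] := boolP (y \in X); last first.
  by rewrite insert_edge_outside // nlinked.
rewrite /= /insert_edge imset_f // andbF orbF placed_sym placedE edge_sym.
have -> : edge G (g j) x = false.
  apply: contraNF xports; rewrite -in_neighbours neighbours_g.
  by case/imsetP => a _ ->; apply/imsetP; exists (j, a).
symmetry; apply/norP; split; last first.
  by apply/negP => /linked_notin; rewrite imset_f ?andbF.
by apply: contra xX => /imsetP[i _ ->]; rewrite imset_f.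
Qed.

Lemma max_degree_insert : max_degree Q <= d -> max_degree insert <= d.
Proof.
move=> dQ; apply/max_degreeP => x.
have [|xD] := boolP (x \in X :|: ports); last first.
  by rewrite /deg -(agree_off_neighbours agree_off_insert xD) deg_leq.
case/setUP => /imsetP[i _ ->]; last by rewrite deg_insert_nbr.
by rewrite (deg_component component_emb_insert) deg_leq.
Qed.

Lemma edit_dist_insert : edit_dist G insert <= (#|U| * #|A|.+1) ^ 2.
Proof.
apply: leq_trans (agree_off_edit_dist agree_off_insert) _; rewrite leq_exp2r //.
apply: leq_trans (leq_card_setU _ _) _; rewrite mulnS -card_prod -!cardsT.
exact: leq_add (leq_imset_card _ _) (leq_imset_card _ _).
Qed.

Lemma neighbours_insert_far x : (forall i, ~~ dist_le G 1 (g i) x) ->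
  neighbours insert x = neighbours G x.
Proof.
move=> farx; symmetry; apply: agree_off_neighbours agree_off_insert _.
apply/negP => /setUP[]/imsetP[i _ xE]; have := farx.
  by move=> /(_ i); rewrite xE dist_le_refl.
by move=> /(_ i.1); rewrite xE dist_le_nbr.
Qed.

Lemma type_set_insert r d' (tau : rtype r) : 0 < r ->
  rtype_degree_le tau d' ->
  d' < d -> r + r <= rho -> type_set tau insert \subset type_set tau G :|: X.
Proof.
move=> r_gt0 degtau d'd r_rho.
have Dg i : neighbours G (g i) \subset X :|: ports.
  apply/subsetP => w; rewrite neighbours_g => /imsetP[a _ ->].
  by apply/setUP; right; apply/imsetP; exists (i, a).
apply: (type_set_surgery r_gt0 degtau agree_off_insert) => [x|||].
- by case/setUP => [->//|/imsetP[p _ ->] _]; rewrite deg_insert_nbr.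
- exact: closed_component component_emb_insert.
- move=> x y xy nxy.
  have [/imsetP[i _ ->]|xX] := boolP (x \in X); first by rewrite Dg.
  have [/imsetP[i _ ->]|yX] := boolP (y \in X); first by rewrite Dg orbT.
  by rewrite insert_edge_outside // xy orbT in nxy.
move=> x y + nxy xX yX; rewrite insert_edge_outside // (negbTE nxy) orbF.
case/existsP => a /existsP[i /existsP[j /and3P[/eqP-> /eqP-> ij]]].
by apply: contraL ij => /(dist_leW r_rho)/nbr_near_eq ->; rewrite edge_irr.
Qed.

End Insertion.

(** * Distant vertices whose neighbours have equal degrees *)

Lemma ex_independent_seq (V : finType) (e : rel V) b m (A : {set V}) :
  0 < b -> (forall x, #|[set y | e x y]| <= b) -> m * b <= #|A| ->
  exists s : seq V, [/\ size s = m, {subset s <= A} &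
    pairwise (fun x y => ~~ e x y) s].
Proof.
move=> b_gt0 eb; elim: m A => [|m IHm] A; first by exists [::].
rewrite mulSn => leA.
have /card_gt0P[x xA] : 0 < #|A| by lia.
have leA' : m * b <= #|A :\: [set y | e x y]|.
  have := cardsID [set y | e x y] A.
  have := subset_leq_card (subsetIr A [set y | e x y]); have := eb x; lia.
have [s [sm sA sp]] := IHm _ leA'.
exists (x :: s); split=> /=; first by rewrite sm.
- by move=> y; rewrite inE => /orP[/eqP->//|/sA]; rewrite inE => /andP[].
- by rewrite sp andbT; apply/allP => y /sA; rewrite !inE => /andP[].
Qed.

Lemma pigeonhole_leq (V C : finType) (c : V -> C) (A : {set V}) m :
  0 < #|C| -> #|C| * m <= #|A| -> exists k, m <= #|[set x in A | c x == k]|.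
Proof.
case: m => [|m] C_gt0 leA; first by have /card_gt0P[k _] := C_gt0; exists k.
apply/existsP; apply: contraLR leA; rewrite negb_exists -ltnNge.
move=> /forallP small.
apply: (@leq_ltn_trans (#|C| * m)); last by rewrite ltn_pmul2l.
have -> : #|A| = \sum_k #|[set x in A | c x == k]|.
  rewrite -sum1_card (partition_big c xpredT) //=; apply: eq_bigr => k _.
  by rewrite -sum1_card; apply: eq_bigl => x; rewrite inE.
rewrite -sum_nat_const; apply: leq_sum => k _.
by have := small k; rewrite -ltnNge.
Qed.

Section DegreeProfile.
Variables (V : finType) (G : graph V) (d : nat).
Hypothesis max_degree_G : max_degree G <= d.

Definition degree_profile x : seq nat :=
  [seq deg G y | y <- enum (neighbours G x)].

Lemma size_degree_profile x : size (degree_profile x) = deg G x.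
Proof. by rewrite size_map -cardE. Qed.

Lemma ex_profile_class (A : {set V}) m : #|{bseq d of 'I_d.+1}| * m <= #|A| ->
  exists2 p, size p <= d & m <= #|[set x in A | degree_profile x == p]|.
Proof.
pose c x : {bseq d of 'I_d.+1} := insub_bseq d (map inord (degree_profile x)).
have cE x : map val (c x) = degree_profile x.
  rewrite insubdK; last first.
    by rewrite unfold_in size_map size_degree_profile deg_leq.
  rewrite -map_comp -[RHS]map_id; apply/eq_in_map => _ /mapP[y _ ->] /=.
  by rewrite inordK // ltnS deg_leq.
move=> /(pigeonhole_leq c)[|k mk]; first by apply/card_gt0P; exists [bseq].
exists (map val k); first by rewrite size_map size_bseq.
apply: leq_trans mk (subset_leq_card _); apply/subsetP => x.
by rewrite !inE => /andP[-> /eqP <-]; rewrite cE eqxx.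
Qed.

Lemma ex_far_same_profile (U : finType) rho (A : {set V}) :
  #|{bseq d of 'I_d.+1}| * (#|U| * d.+1 ^ rho) <= #|A| ->
  exists (g : U -> V) p, [/\ size p <= d, forall i, g i \in A,
    forall i j, i != j -> ~~ dist_le G rho (g i) (g j) &
    forall i, degree_profile (g i) = p].
Proof.
case/ex_profile_class => p pd leA.
have [|x|s [sU sA far_s]] := ex_independent_seq (e := dist_le G rho) _ _ leA.
- by rewrite expn_gt0.
- exact: card_nbhd_leq.
case: s sU sA far_s => [|x0 s] sU sA far_s.
  suff g : U -> V by exists g, p; split=> // i; have := fintype0 i (esym sU).
  by move=> i; case: (fintype0 i (esym sU)).
pose g (i : U) := nth x0 (x0 :: s) (enum_rank i).
have gA i : g i \in [set x in A | degree_profile x == p].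
  by apply: sA; rewrite mem_nth // sU.
exists g, p; split=> // [i|i j|i].
- by have := gA i; rewrite inE => /andP[].
- have far x y : enum_rank x < enum_rank y -> ~~ dist_le G rho (g x) (g y).
    by move=> xy; apply: (elimT (pairwiseP x0) far_s) => //; rewrite inE sU.
  rewrite -(inj_eq enum_rank_inj) -val_eqE /= neq_ltn => /orP[/far//|/far].
  by rewrite dist_le_sym.
- by have := gA i; rewrite inE => /andP[_ /eqP].
Qed.

End DegreeProfile.

Section ExInsertion.
Variables (r d' d : nat) (tau : rtype r).
Hypothesis r_gt0 : 0 < r.
Hypothesis d'_lt_d : d' < d.
Hypothesis degree_tau : rtype_degree_le tau d'.

Variables (U : finType) (Q : graph U).
Hypothesis even_U : ~~ odd #|U|.
Hypothesis double_le_U : d.*2 <= #|U|.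
Hypothesis max_degree_Q : max_degree Q <= d.

Definition is_insertion (V : finType) (G H : graph V) (F : {set V})
    (g : U -> V) : Prop :=
  [/\ max_degree H <= d, edit_dist G H <= (#|U| * d.+1) ^ 2,
      component_emb Q H g /\ (forall i, g i \notin F),
      {in F, forall x, deg H x = deg G x} &
      type_set tau H \subset type_set tau G :|: g @: [set: U]].

Lemma ex_insertion_at (V : finType) (G : graph V) (F : {set V}) (g : U -> V) p :
  max_degree G <= d -> size p <= d ->
  (forall i x, x \in F -> ~~ dist_le G 1 (g i) x) ->
  (forall i j, i != j -> ~~ dist_le G (r + r).+2 (g i) (g j)) ->
  (forall i, degree_profile G (g i) = p) ->
  exists H, is_insertion G H F g.
Proof.
move=> dG pd farF far_g profile_g.
have ex_regular k : exists R : graph U, k <= d -> forall i, deg R i = k.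
  have [kd|_] := leqP k d; last by exists Q.
  have [|R degR] := ex_regular_graph even_U (k := k); last by exists R.
  by apply: leq_trans double_le_U; rewrite leq_double.
have [regular regularP] := boolp.choice ex_regular.
pose nbr i (a : 'I_(size p)) := nth (g i) (enum (neighbours G (g i))) a.
have size_nbr i : size (enum (neighbours G (g i))) = size p.
  by rewrite -(profile_g i) size_map.
have neighbours_g i : neighbours G (g i) = nbr i @: [set: 'I_(size p)].
  apply/setP => x; rewrite -mem_enum; apply/nthP/imsetP => [[a ai <-]|[a _ ->]].
    by rewrite size_nbr in ai; exists (Ordinal ai).
  by exists a; rewrite ?size_nbr.
have nbr_inj i : injective (nbr i).
  move=> a b /eqP; rewrite nth_uniq ?enum_uniq ?size_nbr //.
  by move=> /eqP/val_inj.
have deg_nbr i a : deg G (nbr i a) = nth 0 p a.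
  by rewrite -[X in nth _ X _](profile_g i) (nth_map (g i)) ?size_nbr.
pose link (a : 'I_(size p)) := regular (d - nth 0 p a).+1.
have deg_link a i : deg (link a) i = (d - deg G (nbr i a)).+1.
  rewrite deg_nbr regularP // ltn_subrL (leq_ltn_trans _ d'_lt_d) // andbT.
  rewrite -(deg_nbr i).
  apply/card_gt0P; exists (g i); rewrite in_neighbours edge_sym -in_neighbours.
  by rewrite neighbours_g imset_f.
have rho_gt0 : 0 < r + r by rewrite addn_gt0 r_gt0.
exists (insert Q link far_g neighbours_g nbr_inj); split.
- exact: (max_degree_insert rho_gt0).
- apply: leq_trans (edit_dist_insert _ _ _ _ _) _.
  by rewrite leq_exp2r // leq_mul2l card_ord ltnS pd orbT.
- split=> [|i]; first exact: component_emb_insert.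
  by apply/negP => /(farF i); rewrite dist_le_refl.
- by move=> x xF; rewrite /deg neighbours_insert_far // => i; apply: farF.
- exact: (type_set_insert _ rho_gt0 _ _ _ deg_link dG r_gt0 degree_tau d'_lt_d).
Qed.

Lemma ex_insertion m : exists n0,
  forall (V : finType) (G : graph V) (F : {set V}),
  n0 <= #|V| -> #|F| <= m -> max_degree G <= d ->
  exists H g, is_insertion G H F g.
Proof.
pose colours := #|{bseq d of 'I_d.+1}|.
exists (colours * (#|U| * d.+1 ^ (r + r).+2) + m * d.+1) => V G F leV Fm dG.
pose B := \bigcup_(x in F) nbhd G 1 x.
have cardB : #|B| <= m * d.+1.
  apply: leq_trans (leq_mul Fm (leqnn _)).
  by apply: card_bigcup_leq => x _; rewrite -[d.+1]expn1 card_nbhd_leq.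
have leA : colours * (#|U| * d.+1 ^ (r + r).+2) <= #|~: B|.
  by have := cardsC B; lia.
have [g [p [pd gA far_g profile_g]]] := ex_far_same_profile dG leA.
have farF i x : x \in F -> ~~ dist_le G 1 (g i) x.
  move=> xF; have := gA i; rewrite in_setC; apply: contra => ix.
  by apply/bigcupP; exists x; rewrite // inE dist_le_sym.
by have [H HP] := ex_insertion_at dG pd farF far_g profile_g; exists H, g.
Qed.

End ExInsertion.

(** * Removing all vertices of a type *)

Lemma even_sum_deg (V : finType) (G : graph V) : ~~ odd (\sum_v deg G v).
Proof.
have degE v : deg G v = \sum_w edge G v w.
  rewrite /deg -sum1_card big_mkcond; apply: eq_bigr => w _.
  by rewrite in_neighbours.
pose e v w := if enum_rank v < enum_rank w then edge G v w : nat else 0.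
have -> : \sum_v deg G v = (\sum_v \sum_w e v w) + \sum_v \sum_w e v w.
  rewrite [X in _ + X]exchange_big -big_split /=; apply: eq_bigr => v _.
  rewrite degE -big_split /=; apply: eq_bigr => w _; rewrite /e.
  case: ltngtP => [||/val_inj/enum_rank_inj->]; rewrite ?addn0 ?add0n //.
    by rewrite edge_sym.
  by rewrite edge_irr.
by rewrite addnn odd_double.
Qed.

Lemma ex_odd_deficiency (V : finType) (G : graph V) d v :
  max_degree G <= d -> ~~ odd (d * #|V|) -> odd (d - deg G v) ->
  exists2 u, u != v & odd (d - deg G u).
Proof.
move=> dG even_dV odd_v; apply/exists_inP; apply: contraNT even_dV => no_odd.
have -> : d * #|V| = \sum_(u : V) (d - deg G u) + \sum_(u : V) deg G u.
  rewrite -big_split /= mulnC -sum_nat_const; apply: eq_bigr => u _.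
  by rewrite subnK ?deg_leq.
rewrite oddD (negbTE (even_sum_deg G)) addbF (bigD1 v) //= oddD odd_v.
rewrite addTb -dvdn2; apply: dvdn_sum => u uv; rewrite dvdn2.
by apply: contra no_odd => odd_u; apply/exists_inP; exists u.
Qed.

Section Removal.
Variables (r d' d : nat) (tau : rtype r).
Hypothesis r_gt0 : 0 < r.
Hypothesis d'_lt_d : d' < d.
Hypothesis degree_tau : rtype_degree_le tau d'.

Section InsertSaturate.
Variables (W : finType) (C : graph W) (Z : {set W}).
Hypothesis even_W : ~~ odd #|W|.
Hypothesis max_degree_C : max_degree C <= d.
Hypothesis type_set_C : type_set tau C \subset Z.

Lemma ex_bipartite_insertion m : exists c n0,
  forall (V : finType) (G : graph V) (F : {set V}),
  n0 <= #|V| -> #|F| <= m -> max_degree G <= d ->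
  exists (H : graph V) f h, [/\ max_degree H <= d, edit_dist G H <= c,
    [/\ component_emb (complete_bipartite 'I_d) H f, component_emb C H h,
        [disjoint F :|: h @: Z & f @: [set: bool * 'I_d]] &
        [disjoint F & h @: Z]],
    {in F, forall x, deg H x = deg G x} &
    type_set tau H \subset type_set tau G :|: h @: Z].
Proof.
pose Q := graph_sum (complete_bipartite 'I_d) C.
have even_Q : ~~ odd #|{: bool * 'I_d + W}|.
  by rewrite card_sum card_prod card_bool card_ord oddD mul2n odd_double.
have double_le_Q : d.*2 <= #|{: bool * 'I_d + W}|.
  by rewrite card_sum card_prod card_bool card_ord mul2n leq_addr.
have dQ : max_degree Q <= d.
  apply: max_degree_graph_sum max_degree_C.
  by apply/max_degreeP => x; rewrite deg_complete_bipartite card_ord.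
have [n0 insP] := ex_insertion r_gt0 d'_lt_d degree_tau even_Q double_le_Q dQ m.
exists ((#|{: bool * 'I_d + W}| * d.+1) ^ 2), n0 => V G F leV Fm dG.
have [H [g [dH eH [gQ gF] degF tH]]] := insP V G F leV Fm dG.
have fH := component_emb_comp (component_emb_inl _ C) gQ.
have hH := component_emb_comp (component_emb_inr _ C) gQ.
have F_g (A : {set bool * 'I_d + W}) : [disjoint F & g @: A].
  rewrite disjoint_sym disjoints_subset; apply/subsetP => _ /imsetP[i _ ->].
  by rewrite inE.
exists H, (g \o inl), (g \o inr); split=> //.
- rewrite (imset_comp g inr) (imset_comp g inl).
  split=> //; rewrite disjoints_subset subUset -!disjoints_subset F_g.
  rewrite imset_disjoint; last exact: gQ.1.
  by apply/pred0P => x; apply/negbTE/negP => /andP[/imsetP[j _ ->] /imsetP[]].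
- apply/subsetP => x xH; have := subsetP tH x xH; rewrite !in_setU.
  case/orP => [->//|/imsetP[[i|j] _ xE]]; apply/orP; right.
    suff dx : d' < deg H x.
      by rewrite (negbTE (type_set_deg r_gt0 degree_tau dx)) in xH.
    by rewrite xE (deg_component fH) deg_complete_bipartite card_ord.
  rewrite xE; apply/imset_f/(subsetP type_set_C)/type_setP.
  by apply/(has_type_component hH)/type_setP; rewrite /= -xE.
Qed.

(* The deficiencies of F and of the new vertices in Z are saturated together. *)
Lemma ex_repair_insert : exists c n0,
  forall (V : finType) (G : graph V) (F : {set V}),
  n0 <= #|V| -> #|F| + #|Z| <= 2 -> max_degree G <= d ->
  ~~ odd (\sum_(x in F) (d - deg G x) + \sum_(z in Z) (d - deg C z)) ->
  exists H, is_repair d tau c G H F.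
Proof.
have [c [n0 insP]] := ex_bipartite_insertion 2.
exists (c + (4 * d) ^ 2), n0 => V G F leV leFZ dG even_sum.
have [|H [f [h [dH eH [fH hH disj_f disj_h] degF tH]]]] := insP V G F leV _ dG.
  exact: leq_trans (leq_addr _ _) leFZ.
have sumE : \sum_(x in F :|: h @: Z) (d - deg H x) =
    \sum_(x in F) (d - deg G x) + \sum_(z in Z) (d - deg C z).
  rewrite (eq_bigl [predU F & h @: Z]); last by move=> x; rewrite !inE.
  rewrite bigU //=; congr (_ + _).
    by apply: eq_bigr => x xF; rewrite degF.
  rewrite big_imset /=; last by move=> i j _ _ /hH.1.
  by apply: eq_bigr => z _; rewrite (deg_component hH).
have sum_le : \sum_(x in F :|: h @: Z) (d - deg H x) <= d.*2.
  apply: (@leq_trans (#|F :|: h @: Z| * d)).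
    by rewrite -sum_nat_const; apply: leq_sum => x _; apply: leq_subr.
  rewrite -mul2n leq_mul2r; apply/orP; right; apply: leq_trans leFZ.
  by apply: leq_trans (leq_card_setU _ _) _; rewrite leq_add2l leq_imset_card.
rewrite -sumE in even_sum.
have [K [dK eK tK]] :=
  ex_saturation r_gt0 d'_lt_d degree_tau dH fH disj_f even_sum sum_le.
exists K; split=> //.
  exact: leq_trans (edit_dist_trans G H K) (leq_add eH eK).
apply: subset_trans tK _; rewrite setUC -setDDl; apply: setSD.
by rewrite subDset setUC.
Qed.

End InsertSaturate.

(* Without such a graph, tau-freeness may be unsatisfiable on an odd number of
   vertices: take d = 1 and the type of an isolated vertex. *)
Definition odd_free_graph : Prop :=
  exists n (Q : graph 'I_n), [/\ odd n, max_degree Q <= d & nbhd_free tau Q].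

Definition odd_obstruction : bool := odd d && ~~ `[< odd_free_graph >].

Lemma odd_obstruction_free n (G : graph 'I_n) :
  odd_obstruction -> odd n -> max_degree G <= d -> ~ nbhd_free tau G.
Proof.
by move=> /andP[_ /asboolP no] odd_n dG freeG; apply: no; exists n, G.
Qed.

Lemma no_odd_obstruction n :
  ~~ (odd_obstruction && odd n) -> ~~ odd (d * n) \/ odd_free_graph.
Proof.
move=> no_obs; have [free|no_free] := EM odd_free_graph; [by right|left].
move: no_obs; rewrite /odd_obstruction oddM.
by case: (odd d) => //=; case: asboolP.
Qed.

Lemma ex_repair_even : exists c n0,
  forall (V : finType) (G : graph V) (F : {set V}),
  n0 <= #|V| -> #|F| <= 2 -> max_degree G <= d ->
  ~~ odd (\sum_(x in F) (d - deg G x)) -> exists H, is_repair d tau c G H F.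
Proof.
have [|||c [n0 repP]] := @ex_repair_insert _ (empty_graph void) set0.
- by rewrite card_void.
- by apply/max_degreeP => -[].
- by apply/subsetP => -[].
exists c, n0 => V G F leV F2 dG even_F.
by apply: repP; rewrite ?cards0 ?big_set0 ?addn0.
Qed.

Lemma ex_repair_odd : odd d -> odd_free_graph ->
  exists c n0, forall (V : finType) (G : graph V) v,
  n0 <= #|V| -> max_degree G <= d -> odd (d - deg G v) ->
  exists H, is_repair d tau c G H [set v].
Proof.
move=> odd_d [n [Q [odd_n dQ freeQ]]].
pose C := graph_sum Q (empty_graph unit).
have [|||c [n0 repP]] := @ex_repair_insert _ C [set inr tt].
- by rewrite card_sum card_ord card_unit oddD odd_n.
- apply: max_degree_graph_sum => //.
  by apply/max_degreeP => x; rewrite deg_empty_graph.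
- apply/subsetP => -[i|[]]; last by rewrite set11.
  by move/type_setP/(has_type_component (component_emb_inl _ _))/freeQ.
exists c, n0 => V G v leV dG odd_v; apply: repP; rewrite ?cards1 //.
rewrite !big_set1 (deg_component (component_emb_inr _ _)) deg_empty_graph subn0.
by rewrite oddD odd_v odd_d.
Qed.

Lemma ex_repair : exists c n0, forall (V : finType) (G : graph V) v,
  n0 <= #|V| -> ~~ odd (d * #|V|) \/ odd_free_graph -> max_degree G <= d ->
  exists H, is_repair d tau c G H [set v].
Proof.
have [c1 [n1 repair_even]] := ex_repair_even.
have [c2 [n2 repair_odd]] : exists c n0, forall (V : finType) (G : graph V) v,
    n0 <= #|V| -> odd d /\ odd_free_graph -> max_degree G <= d ->
    odd (d - deg G v) -> exists H, is_repair d tau c G H [set v].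
  have [[odd_d free]|no] := EM (odd d /\ odd_free_graph); last by exists 0, 0.
  have [c [n0 repP]] := ex_repair_odd odd_d free.
  by exists c, n0 => V G v leV _; apply: repP.
exists (c1 + c2), (maxn n1 n2) => V G v.
rewrite geq_max => /andP[leV1 leV2] parity dG.
have [odd_v|even_v] := boolP (odd (d - deg G v)); last first.
  have [||H HP] := repair_even V G [set v] leV1 _ dG; first by rewrite cards1.
    by rewrite big_set1.
  by exists H; apply: repairW HP; rewrite ?leq_addr.
have [odd_dV|even_dV] := boolP (odd (d * #|V|)); last first.
  have [u uv odd_u] := ex_odd_deficiency dG even_dV odd_v.
  have [||H HP] := repair_even V G [set v; u] leV1 _ dG.
  - by rewrite cards2; case: (_ != _).
  - by rewrite big_setU1 ?big_set1 ?oddD ?odd_v ?odd_u // inE eq_sym.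
  by exists H; apply: repairW HP; rewrite ?leq_addr // sub1set !inE eqxx.
have [|free] := parity; first by rewrite odd_dV.
have odd_d : odd d by move: odd_dV; rewrite oddM => /andP[].
have [H HP] := repair_odd V G v leV2 (conj odd_d free) dG odd_v.
by exists H; apply: repairW HP; rewrite ?leq_addl.
Qed.

Lemma ex_removal : exists c n0, forall n (G : graph 'I_n),
  n0 <= n -> ~~ odd (d * n) \/ odd_free_graph -> max_degree G <= d ->
  exists H, [/\ max_degree H <= d, nbhd_free tau H &
    edit_dist G H <= c * #|type_set tau G|].
Proof.
have [c [n0 repP]] := ex_repair; exists c, n0 => n G leV parity.
rewrite -[n]card_ord in leV parity.
have [k] := ubnP #|type_set tau G|; elim: k G => // k IHk G ltk dG.
have [tG0|[v vG]] := set_0Vmem (type_set tau G).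
  by exists G; split; rewrite ?edit_dist_refl //; apply/nbhd_free_type_set.
have [H [dH eH tH]] := repP _ G v leV parity dG.
have ltH : #|type_set tau H| < #|type_set tau G|.
  by rewrite (cardsD1 v (type_set tau G)) vG ltnS subset_leq_card.
have [K [dK freeK eK]] := IHk H (leq_trans ltH ltk) dH.
exists K; split=> //; apply: leq_trans (edit_dist_trans G H K) _.
apply: leq_trans (leq_add eH eK) _; rewrite -mulnS.
by rewrite leq_mul2l ltH orbT.
Qed.

End Removal.

(** * A program recognizing a type *)

Definition expr_not (e : expr) : expr := Bin Eq e (Const 0).
Definition expr_and : expr -> expr -> expr := Bin Mul.
Definition expr_or : expr -> expr -> expr := Bin Add.
Definition expr_all T (s : seq T) (f : T -> expr) : expr :=
  foldr (fun x => expr_and (f x)) (Const 1) s.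
Definition expr_has T (s : seq T) (f : T -> expr) : expr :=
  foldr (fun x => expr_or (f x)) (Const 0) s.
Definition expr_iff (b : bool) (e : expr) : expr := if b then e else expr_not e.

Section EvalConnectives.
Variables (R : realType) (eps : R) (n : nat) (m : memory).
Local Notation holds e := (eval eps n m e != 0).

Lemma eval_not e : holds (expr_not e) = ~~ holds e.
Proof. by rewrite /= eqb0. Qed.

Lemma eval_and e1 e2 : holds (expr_and e1 e2) = holds e1 && holds e2.
Proof. by rewrite /= muln_eq0 negb_or. Qed.

Lemma eval_or e1 e2 : holds (expr_or e1 e2) = holds e1 || holds e2.
Proof. by rewrite /= addn_eq0 negb_and. Qed.

Lemma eval_eq e1 e2 :
  holds (Bin Eq e1 e2) = (eval eps n m e1 == eval eps n m e2).
Proof. by rewrite /= eqb0 negbK. Qed.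

Lemma eval_all T (s : seq T) f :
  holds (expr_all s f) = all (fun x => holds (f x)) s.
Proof. by elim: s => //= x s IHs; rewrite eval_and IHs. Qed.

Lemma eval_has T (s : seq T) f :
  holds (expr_has s f) = has (fun x => holds (f x)) s.
Proof. by elim: s => //= x s IHs; rewrite eval_or IHs. Qed.

Lemma eval_iff b e : holds (expr_iff b e) = (holds e == b).
Proof. by case: b; rewrite /expr_iff ?eval_not; case: (eval _ _ _ _ == 0). Qed.

End EvalConnectives.

Section WalkTree.
Variables (r d : nat) (B : rooted).

(* The queries explore the d-ary tree of walks from a sampled vertex in heap
   order: the children of node a are d * a + 1, ..., d * a + d, node a is kept
   in cell a + 3, and it holds 0 if the walk does not exist and w + 1 if it ends
   in w. Cell 0 holds the verdict, cell 1 the bound on 1 / eps, and cell 2 the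
   number of remaining samples. *)
Fixpoint tree_size k : nat := if k is k'.+1 then d * tree_size k' + 1 else 1.

Definition node_cell (a : nat) : nat := a + 3.

Definition node (a : nat) : expr := Cell (Const (node_cell a)).

(* The address n is not a vertex, so that the query is answered by 0. *)
Definition node_vertex (a : nat) : expr :=
  Bin Add (Bin Defs.Sub (node a) (Const 1)) (Bin Mul Nvert (expr_not (node a))).

Definition load_cmd (s : seq nat) : cmd :=
  foldr (fun c k => Seq (Query (Const (node_cell c.+1)) (node_vertex (c %/ d))
                               (Const (c %% d))) k) Skip s.

Definition expr_adj (a b : nat) : expr :=
  expr_has (iota 0 d) (fun i => Bin Eq (node (d * a + i).+1) (node b)).

Definition expr_emb (phi : {ffun bvertex B -> 'I_(tree_size r)}) : expr :=
  expr_and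
    (expr_all (enum (bvertex B)) (fun x => expr_and (node (phi x))
      (expr_all (enum (bvertex B)) (fun y => expr_and
        (expr_iff (x == y) (Bin Eq (node (phi x)) (node (phi y))))
        (expr_iff (edge (bgraph B) x y) (expr_adj (phi x) (phi y)))))))
  (expr_and
    (Bin Eq (node (phi (centre B))) (node 0))
    (expr_all (iota 0 (tree_size r)) (fun a => expr_or (expr_not (node a))
      (expr_has (enum (bvertex B))
        (fun x => Bin Eq (node a) (node (phi x))))))).

Definition expr_type : expr :=
  expr_has (enum {ffun bvertex B -> 'I_(tree_size r)}) expr_emb.

Section EvalType.
Variables (R : realType) (eps : R) (n : nat) (m : memory).
Local Notation holds e := (eval eps n m e != 0).
Local Notation val_at a := (m (node_cell a)).

Definition tree_adj (a b : nat) : bool :=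
  has (fun i => val_at (d * a + i).+1 == val_at b) (iota 0 d).

Definition tree_emb (phi : bvertex B -> 'I_(tree_size r)) : Prop :=
  [/\ forall x, val_at (phi x) != 0,
      forall x y, (val_at (phi x) == val_at (phi y)) = (x == y),
      forall x y, tree_adj (phi x) (phi y) = edge (bgraph B) x y,
      val_at (phi (centre B)) = val_at 0
    & forall a, a < tree_size r -> val_at a != 0 ->
        exists x, val_at a = val_at (phi x)].

Lemma eval_adj a b : holds (expr_adj a b) = tree_adj a b.
Proof. by rewrite eval_has; apply: eq_has => i; rewrite eval_eq. Qed.

Lemma eval_emb (phi : {ffun bvertex B -> 'I_(tree_size r)}) :
  reflect (tree_emb phi) (holds (expr_emb phi)).
Proof.
rewrite !eval_and eval_eq !eval_all.
apply: (iffP and3P) => [[/allP embP /eqP centreP /allP surjP]|].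
  have {}embP x y : [/\ val_at (phi x) != 0,
      (val_at (phi x) == val_at (phi y)) = (x == y) &
      tree_adj (phi x) (phi y) = edge (bgraph B) x y].
    have := embP x (mem_enum _ _); rewrite eval_and eval_all => /andP[nz].
    move=> /allP/(_ y (mem_enum _ _)).
    by rewrite eval_and !eval_iff eval_eq eval_adj => /andP[/eqP ? /eqP].
  split=> // [x|x y|x y|a ar nz]; [by case: (embP x x)|by case: (embP x y)..|].
  have := surjP a; rewrite mem_iota ar => /(_ isT).
  rewrite eval_or eval_not eval_has nz => /hasP[x _].
  by rewrite eval_eq => /eqP xa; exists x.
case=> nzP injP adjP centreP surjP; split; last 1 first.
- apply/allP => a; rewrite mem_iota => /andP[_ ar].
  rewrite eval_or eval_not eval_has.
  have [//|nz] := eqVneq (eval eps n m (node a)) 0.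
  have [x xa] := surjP a ar nz.
  by apply/orP; right; apply/hasP; exists x; rewrite ?mem_enum // eval_eq /= xa.
- apply/allP => x _; rewrite eval_and eval_all nzP; apply/allP => y _.
  by rewrite eval_and !eval_iff eval_eq eval_adj injP adjP !eqxx.
- exact/eqP.
Qed.

Lemma eval_type :
  holds expr_type <->
  exists phi : {ffun bvertex B -> 'I_(tree_size r)}, tree_emb phi.
Proof.
rewrite eval_has; split=> [/hasP[phi _ /eval_emb]|[phi /eval_emb phiP]].
  by exists phi.
by apply/hasP; exists phi; rewrite ?mem_enum.
Qed.

End EvalType.

Section Tree.
Variables (n : nat) (G : graph 'I_n) (adj : 'I_n -> seq 'I_n).
Hypothesis max_degree_G : max_degree G <= d.
Hypothesis adjP : adj_lists G adj.

Definition child (x i : nat) : nat := if x is u.+1 then oracle d adj u i else 0.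

Lemma oracle_edge (u w : 'I_n) :
  edge G u w <-> exists2 i, i < d & oracle d adj u i = w.+1.
Proof.
have [uniq_adj mem_adj] := adjP u.
have size_adj : size (adj u) <= d.
  apply: leq_trans (deg_leq u max_degree_G); rewrite -(card_uniqP uniq_adj).
  by apply: subset_leq_card; apply/subsetP => y; rewrite in_neighbours mem_adj.
rewrite /oracle valK; split=> [uw|[i id]].
  have w_adj : index w (adj u) < size (adj u) by rewrite index_mem mem_adj.
  exists (index w (adj u)); first exact: leq_trans size_adj.
  rewrite (leq_trans w_adj) // (nth_map w) // nth_index //.
  by rewrite -index_mem.
rewrite id; have [lt_i|ge_i] := ltnP i (size (adj u)); last first.
  by rewrite nth_default // size_map.
rewrite (nth_map w) // => -[/val_inj E]; have := mem_nth w lt_i.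
by rewrite E mem_adj.
Qed.

Lemma oracle_vertex u i : oracle d adj u i != 0 ->
  u < n /\ exists w : 'I_n, oracle d adj u i = w.+1.
Proof.
rewrite /oracle; case: insubP => // u' u_n _; case: ifP => // _ nz; split=> //.
have [lt_i|ge_i] := ltnP i (size (adj u')).
  by rewrite (nth_map u') //; exists (nth u' (adj u') i).
by rewrite nth_default ?size_map in nz.
Qed.

Variables (v : 'I_n) (m : memory).
Local Notation val_at a := (m (node_cell a)).

Definition holds_walk_tree : Prop :=
  val_at 0 = v.+1 /\
  forall c, c < d * tree_size r ->
    val_at c.+1 = child (val_at (c %/ d)) (c %% d).

Hypothesis m_tree : holds_walk_tree.

Lemma tree_size_mono j k : j <= k -> tree_size j <= tree_size k.
Proof.
elim: k j => [|k IHk] [|j] //=; first by rewrite addn1.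
by rewrite ltnS => /IHk jk; rewrite leq_add2r leq_mul2l jk orbT.
Qed.

Lemma lt_child_node a k i : a < k -> i < d -> d * a + i < d * k.
Proof.
move=> ak id; apply: (@leq_trans (d * a.+1)); first by lia.
by rewrite leq_mul2l ak orbT.
Qed.

Lemma val_at_child a i : a < tree_size r -> i < d ->
  val_at (d * a + i).+1 = child (val_at a) i.
Proof.
move=> ar id; have d_gt0 : 0 < d by apply: leq_ltn_trans id.
rewrite (m_tree.2 _ (lt_child_node ar id)).
by rewrite mulnC divnMDl // divn_small // addn0 modnMDl modn_small.
Qed.

Lemma walk_tree_dist k (w : 'I_n) : k <= r ->
  dist_le G k v w <-> exists2 a, a < tree_size k & val_at a = w.+1.
Proof.
elim: k w => [|k IHk] w kr.
  rewrite dist_le0; split=> [/eqP<-|[[|//] _]].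
    by exists 0; rewrite // m_tree.1.
  by rewrite m_tree.1 => -[/val_inj->].
have kr' := ltnW kr; have le_r := tree_size_mono kr'.
split=> [/dist_leSP[z /(IHk _ kr')[a ak az]]|[[|c] ck cw]].
- case/orP=> [/eqP<-|/oracle_edge[i id iw]].
    by exists a => //; apply: leq_trans ak (tree_size_mono (leqnSn k)).
  exists (d * a + i).+1; first by rewrite /= addn1 ltnS lt_child_node.
  by rewrite val_at_child ?az // (leq_trans ak).
- by move: cw; rewrite m_tree.1 => -[/val_inj<-]; apply: dist_le_refl.
- rewrite /= addn1 ltnS in ck; have d_gt0 : 0 < d by lia.
  have ck' : c %/ d < tree_size k by rewrite ltn_divLR // mulnC.
  move: cw; rewrite m_tree.2; last first.
    by apply: leq_trans ck _; rewrite leq_mul2l le_r orbT.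
  case E: (val_at _) => [//|u] cw.
  have /oracle_vertex[un _] : oracle d adj u (c %% d) != 0.
    by rewrite [oracle _ _ _ _]cw.
  apply/dist_leSP; exists (Ordinal un).
    by apply/(IHk _ kr'); exists (c %/ d).
  by apply/orP; right; apply/oracle_edge; exists (c %% d); rewrite ?ltn_mod.
Qed.

Lemma nbhd_walk_tree (w : 'I_n) :
  w \in nbhd G r v <-> exists2 a, a < tree_size r & val_at a = w.+1.
Proof. by rewrite inE; apply: walk_tree_dist. Qed.

Lemma walk_tree_vertex a : a < tree_size r -> val_at a != 0 ->
  exists w : 'I_n, val_at a = w.+1.
Proof.
case: a => [|c] ar; first by exists v; rewrite m_tree.1.
rewrite m_tree.2; last first.
  case: (r) ar => [|k] //=; rewrite addn1 ltnS => ck; apply: leq_trans ck _.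
  by rewrite leq_mul2l -addn1 (tree_size_mono (leqnSn k)) orbT.
by rewrite /child; case: (val_at _) => // u /oracle_vertex[].
Qed.

Lemma tree_adjE a b (u w : 'I_n) : a < tree_size r ->
  val_at a = u.+1 -> val_at b = w.+1 -> tree_adj m a b = edge G u w.
Proof.
move=> ar au bw; apply/hasP/idP => [[i]|/oracle_edge[i id iw]].
  rewrite mem_iota => /= id; rewrite val_at_child // au bw => /eqP iw.
  by apply/oracle_edge; exists i.
by exists i; rewrite ?mem_iota // val_at_child // au bw /= iw.
Qed.

Lemma tree_emb_ball_emb (phi : bvertex B -> 'I_(tree_size r)) :
  tree_emb m phi -> exists f : bvertex B -> 'I_n, ball_emb r G v f.
Proof.
case=> nzP injP edgeP centreP surjP.
have ex_vertex x : exists w : 'I_n, val_at (phi x) == w.+1.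
  have [w E] := walk_tree_vertex (ltn_ord (phi x)) (nzP x).
  by exists w; apply/eqP.
pose f x := xchoose (ex_vertex x).
have fE x : val_at (phi x) = (f x).+1 by apply/eqP/(xchooseP (ex_vertex x)).
exists f; split.
- by move=> x y E; apply/eqP; rewrite -injP !fE E.
- by move=> x y; rewrite -edgeP (tree_adjE _ (fE x) (fE y)).
- by apply: val_inj; apply: succn_inj; rewrite -fE centreP m_tree.1.
apply/setP => w; apply/idP/imsetP => [/nbhd_walk_tree[a ar aw]|[x _ ->]].
  have [|x E] := surjP a ar; first by rewrite aw.
  by exists x => //; apply: val_inj; apply: succn_inj; rewrite -fE -E.
by apply/nbhd_walk_tree; exists (phi x).
Qed.

Lemma ball_emb_tree_emb (f : bvertex B -> 'I_n) : ball_emb r G v f ->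
  exists phi : {ffun bvertex B -> 'I_(tree_size r)}, tree_emb m phi.
Proof.
case=> injf ef cf nf.
have ex_node x : exists a : 'I_(tree_size r), val_at a == (f x).+1.
  have /nbhd_walk_tree[a ar E] : f x \in nbhd G r v by rewrite nf imset_f.
  by exists (Ordinal ar); rewrite E.
pose phi := [ffun x => xchoose (ex_node x)].
have fE x : val_at (phi x) = (f x).+1.
  by rewrite ffunE; apply/eqP/(xchooseP (ex_node x)).
exists phi; split.
- by move=> x; rewrite fE.
- by move=> x y; rewrite !fE eqSS val_eqE (inj_eq injf).
- by move=> x y; rewrite (tree_adjE _ (fE x) (fE y)) ?ef.
- by rewrite fE cf m_tree.1.
move=> a ar nz; have [w aw] := walk_tree_vertex ar nz.
have : w \in nbhd G r v by apply/nbhd_walk_tree; exists a.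
by rewrite nf => /imsetP[x _ wx]; exists x; rewrite fE aw wx.
Qed.

Lemma eval_type_ball_emb (R : realType) (eps : R) :
  eval eps n m expr_type != 0 <->
  exists f : bvertex B -> 'I_n, ball_emb r G v f.
Proof.
split=> [/eval_type[phi]|[f]]; first exact: tree_emb_ball_emb.
by move=> /ball_emb_tree_emb ex_phi; apply/eval_type.
Qed.

End Tree.
End WalkTree.

(** * Probabilities of runs *)

Section Runs.
Variables (R : realType) (eps : R) (n d : nat) (adj : 'I_n -> seq 'I_n).
Local Notation prob := (prob eps d adj).
Local Notation halts := (halts_within eps d adj).
Local Notation eval := (eval eps n).
Local Notation step := (step eps d adj).

Lemma probS b t x k m : prob b t.+1 (x :: k, m) =
  ((\sum_(c <- step (x :: k, m)) prob b t c) / (size (step (x :: k, m)))%:R)%R.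
Proof. by []. Qed.

Lemma haltsS t x k m :
  halts t.+1 (x :: k, m) = all (halts t) (step (x :: k, m)).
Proof. by []. Qed.

Lemma prob_halted b t m : prob b t ([::], m) = ((m 0 != 0) == b)%:R%R.
Proof. by case: t. Qed.

Lemma halts_halted t m : halts t ([::], m).
Proof. by case: t. Qed.

Definition leads (t : nat) (c c' : config) : Prop :=
  forall t', (forall b, prob b (t + t') c = prob b t' c') /\
    halts (t + t') c = halts t' c'.

Lemma leads_trans t1 t2 c1 c2 c3 :
  leads t1 c1 c2 -> leads t2 c2 c3 -> leads (t1 + t2) c1 c3.
Proof.
move=> lead12 lead23 t'; have [p12 h12] := lead12 (t2 + t').
have [p23 h23] := lead23 t'.
by rewrite -addnA; split=> [b|]; rewrite ?p12 ?h12.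
Qed.

Lemma leads_step x k m c : step (x :: k, m) = [:: c] -> leads 1 (x :: k, m) c.
Proof.
move=> stepE t'; rewrite add1n; split=> [b|];
  last by rewrite haltsS stepE all_seq1.
by rewrite probS stepE big_seq1 divr1.
Qed.

Lemma leads_halted t T c m : leads t c ([::], m) -> t <= T ->
  halts T c /\ forall b, prob b T c = ((m 0 != 0) == b)%:R%R.
Proof.
move=> lead tT; have [p h] := lead (T - t); rewrite -(subnKC tT) h halts_halted.
by split=> // b; rewrite p prob_halted.
Qed.

Definition runs (c : cmd) (t : nat) (m m' : memory) : Prop :=
  forall k, leads t (c :: k, m) (k, m').

Lemma runs_skip m : runs Skip 1 m m.
Proof. by move=> k; apply: leads_step. Qed.

Lemma runs_store a e m : runs (Store a e) 1 m (update m (eval m a) (eval m e)).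
Proof. by move=> k; apply: leads_step. Qed.

Lemma runs_query a v i m : runs (Query a v i) 1 m
  (update m (eval m a) (oracle d adj (eval m v) (eval m i))).
Proof. by move=> k; apply: leads_step. Qed.

Lemma runs_seq c1 c2 t1 t2 m1 m2 m3 : runs c1 t1 m1 m2 -> runs c2 t2 m2 m3 ->
  runs (Seq c1 c2) (t1 + t2).+1 m1 m3.
Proof.
move=> run1 run2 k; rewrite -add1n.
apply: (leads_trans (c2 := (c1 :: c2 :: k, m1))); first exact: leads_step.
exact: leads_trans (run1 _) (run2 k).
Qed.

Lemma runs_if e c1 c2 t m m' :
  runs (if eval m e != 0 then c1 else c2) t m m' -> runs (If e c1 c2) t.+1 m m'.
Proof.
by move=> run k; rewrite -add1n; apply: leads_trans (run k); apply: leads_step.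
Qed.

Lemma runs_while_stop e c m : eval m e == 0 -> runs (While e c) 1 m m.
Proof. by move=> e0 k; apply: leads_step; rewrite /= e0. Qed.

Lemma runs_while_step e c t1 t2 m1 m2 m3 : eval m1 e != 0 ->
  runs c t1 m1 m2 -> runs (While e c) t2 m2 m3 ->
  runs (While e c) (t1 + t2).+1 m1 m3.
Proof.
move=> e_nz run1 run2 k; rewrite -add1n.
apply: (leads_trans (c2 := (c :: While e c :: k, m1))).
  by apply: leads_step; rewrite /= e_nz.
exact: leads_trans (run1 _) (run2 k).
Qed.

Definition runs_uniform (c : cmd) (t : nat) (m : memory)
    (mx : 'I_n -> memory) : Prop :=
  forall k t',
    (forall b, prob b (t + t') (c :: k, m) =
       ((\sum_x prob b t' (k, mx x)) / n%:R)%R) /\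
    ((forall x, halts t' (k, mx x)) -> halts (t + t') (c :: k, m)).

Lemma runs_uniform_rand a c t m mx : 0 < n ->
  (forall x : 'I_n, runs c t (update m (eval m a) x) (mx x)) ->
  runs_uniform (Seq (Rand a Nvert) c) t.+2 m mx.
Proof.
move=> n_gt0 run k t'; rewrite -add2n -addnA -[2 + _]add1n.
have lead : leads 1 (Seq (Rand a Nvert) c :: k, m) (Rand a Nvert :: c :: k, m).
  exact: leads_step.
have [prob_seq halts_seq] := lead (t + t').+1.
have stepE : step (Rand a Nvert :: c :: k, m) =
    [seq (c :: k, update m (eval m a) (val x)) | x <- enum 'I_n].
  by rewrite /= (maxn_idPr n_gt0) -val_enum_ord -map_comp.
split=> [b|halt_mx].
  rewrite prob_seq probS stepE size_map size_enum_ord big_map big_enum.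
  by congr (_ / _)%R; apply: eq_bigr => x _; have [] := run x k t'.
rewrite halts_seq haltsS stepE all_map; apply/allP => x _ /=.
by have [_ ->] := run x k t'; apply: halt_mx.
Qed.

Fixpoint loaded (m : memory) (l : nat) : memory :=
  if l is l'.+1 then
    let m' := loaded m l' in
    update m' (node_cell l) (child d adj (m' (node_cell (l' %/ d))) (l' %% d))
  else m.

Lemma runs_load m s l :
  runs (load_cmd d (iota s l)) l.*2.+1 (loaded m s) (loaded m (s + l)).
Proof.
elim: l s => [|l IHl] s; first by rewrite addn0; apply: runs_skip.
rewrite addnS -addSn -[l.+1.*2.+1]/((1 + l.*2.+1).+1).
apply: runs_seq (IHl s.+1); rewrite [loaded m s.+1]/=; set m' := loaded m s.
have -> : child d adj (m' (node_cell (s %/ d))) (s %% d) =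
    oracle d adj (eval m' (node_vertex (s %/ d))) (s %% d).
  rewrite /=; case: (m' _) => [|u] /=; last by rewrite muln0 addn0 subn1.
  by rewrite muln1 add0n /oracle insubN // ltnn.
exact: runs_query.
Qed.

Lemma loaded_low m l a : a <= 3 -> loaded m l a = m a.
Proof.
move=> a3; elim: l => //= l IHl; rewrite /update IHl /node_cell.
by case: eqP => //; lia.
Qed.

Lemma loaded_node m l c : c < l -> loaded m l (node_cell c.+1) =
  child d adj (loaded m l (node_cell (c %/ d))) (c %% d).
Proof.
elim: l => // l IHl; rewrite ltnS => cl /=; rewrite /update !eqn_add2r.
have cd : c %/ d <= c by apply: leq_div.
rewrite (ltn_eqF (leq_ltn_trans cd _)) // eqSS.
by move: cl; rewrite leq_eqVlt => /predU1P[->|cl];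
  rewrite ?eqxx // ltn_eqF ?IHl.
Qed.

Lemma loaded_walk_tree r m l (v : 'I_n) :
  m 3 = v.+1 -> d * tree_size d r <= l ->
  holds_walk_tree r d adj v (loaded m l).
Proof.
move=> m3 le_l; split=> [|c cr]; first by rewrite loaded_low.
exact: loaded_node (leq_trans cr le_l).
Qed.

Definition search_inv_eps : cmd :=
  While (expr_not (LeEps (Const 1) (Cell (Const 1))))
        (Store (Const 1) (Bin Add (Cell (Const 1)) (Const 1))).

Lemma runs_search_inv_eps j m :
  (forall i, (1 <= eps * i%:R)%R = (m 1 + j <= i)) ->
  exists m', [/\ runs search_inv_eps j.*2.+1 m m', m' 1 = m 1 + j & m' 0 = m 0].
Proof.
elim: j m => [|j IHj] m le_eps.
  exists m; split; rewrite ?addn0 //; apply: runs_while_stop.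
  by rewrite /= le_eps addn0 leqnn.
pose m1 := update m 1 (m 1 + 1).
have m1j : m1 1 + j = m 1 + j.+1 by rewrite /m1 /update /=; lia.
have [|m' [run_m' m'1 m'0]] := IHj m1; first by move=> i; rewrite le_eps m1j.
exists m'; split=> //; last by rewrite m'1.
rewrite -[j.+1.*2.+1]/((1 + j.*2.+1).+1); apply: runs_while_step run_m'.
  by rewrite eval_not negbK /= le_eps eqb0; lia.
exact: runs_store.
Qed.

End Runs.

(** * The tester *)

Section RealBounds.
Local Open Scope ring_scope.
Variable R : realType.

Lemma onem_exp_bernoulli (p : R) t :
  0 <= p <= 1 -> (1 - p) ^+ t * (1 + t%:R * p) <= 1.
Proof.
move=> /andP[p_ge0 p_le1]; elim: t => [|t IHt].
  by rewrite expr0 mul0r addr0 mulr1.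
apply: le_trans IHt; rewrite exprSr -mulrA ler_wpM2l ?exprn_ge0 ?subr_ge0 //.
have tpp_ge0 : 0 <= t%:R * p * p by rewrite !mulr_ge0 ?ler0n.
have pp_ge0 : 0 <= p * p by rewrite mulr_ge0.
rewrite -natr1; lra.
Qed.

Lemma onem_exp_le_third (p : R) t :
  0 <= p <= 1 -> 2 <= t%:R * p -> (1 - p) ^+ t <= 1 / 3.
Proof.
move=> p01 tp; have le1 := onem_exp_bernoulli t p01.
have pow_ge0 : 0 <= (1 - p) ^+ t.
  by rewrite exprn_ge0 // subr_ge0; case/andP: p01.
have : (1 - p) ^+ t * 3 <= (1 - p) ^+ t * (1 + t%:R * p).
  by rewrite ler_wpM2l //; lra.
lra.
Qed.

Definition inv_ceil (eps : R) : nat := `|Num.ceil eps^-1|%N.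

Lemma inv_ceilP (eps : R) i :
  0 < eps -> (1 <= eps * i%:R) = (inv_ceil eps <= i)%N.
Proof.
move=> eps_gt0; rewrite -lez_nat /inv_ceil gez0_abs ?ceil_le_int; last first.
  by rewrite ceil_ge0 (lt_trans _ (_ : 0 < eps^-1)) ?invr_gt0 // ltrN10.
by rewrite -ler_pdivrMl // mulr1.
Qed.

Lemma sum_if_set (I : finType) (S : {set I}) (y z : R) :
  \sum_i (if i \in S then y else z) = #|S|%:R * y + (#|I|%:R - #|S|%:R) * z.
Proof.
rewrite (bigID (mem S)) /= (eq_bigr (fun=> y)) => [|i ->//].
rewrite [X in _ + X](eq_bigr (fun=> z)) => [|i /negbTE->//].
rewrite sumr_const (eq_bigl (mem (~: S))) => [|i]; last by rewrite !inE.
by rewrite sumr_const -(cardsC S) natrD [X in X - _]addrC addrK !mulr_natl.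
Qed.

(* The probability of the verdict b after j more samples, each of which fails
   with probability p, if the verdict is to accept unless a sample fails or
   [accepting] is false. *)
Definition samples_prob (p : R) (j : nat) (accepting b : bool) : R :=
  if accepting then if b then (1 - p) ^+ j else 1 - (1 - p) ^+ j else (~~ b)%:R.

Lemma samples_prob0 p accepting b :
  samples_prob p 0 accepting b = (accepting == b)%:R.
Proof. by rewrite /samples_prob expr0 subrr; case: accepting; case: b. Qed.

Lemma samples_probS p j accepting b : samples_prob p j.+1 accepting b =
  p * samples_prob p j false b + (1 - p) * samples_prob p j accepting b.
Proof.
by rewrite /samples_prob exprS; case: accepting; case: b => /=; ring.
Qed.

End RealBounds.

Section Tester.
Variables (r d : nat) (B : rooted).

Definition load_size : nat := d * tree_size d r.

Definition check_cmd : cmd :=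
  Seq (Store (Const 3) (Bin Add (Cell (Const 3)) (Const 1)))
  (Seq (load_cmd d (iota 0 load_size))
  (Seq (If (expr_type r d B) (Store (Const 0) (Const 0)) Skip)
       (Store (Const 2) (Bin Defs.Sub (Cell (Const 2)) (Const 1))))).

Definition check_time : nat := load_size.*2 + 8.

Definition sample_cmd : cmd := Seq (Rand (Const 3) Nvert) check_cmd.

Definition sample_loop : cmd := While (Cell (Const 2)) sample_cmd.

Definition tester (reject_odd : bool) (c : nat) : cmd :=
  If (expr_not Nvert) (Store (Const 0) (Const 1))
  (If (expr_and (Const reject_odd) (Bin Mod Nvert (Const 2))) Skip
  (Seq (Store (Const 0) (Const 1))
  (Seq search_inv_eps
  (Seq (Store (Const 2) (Bin Mul (Const c) (Cell (Const 1))))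
       sample_loop)))).

Definition tester_time (c q : nat) : nat := 10 + q.*2 + (c * q) * check_time.+3.

Variables (R : realType) (eps : R) (n : nat) (G : graph 'I_n).
Variable adj : 'I_n -> seq 'I_n.
Local Notation prob := (prob eps d adj).
Local Notation halts := (halts_within eps d adj).

Lemma tester_empty reject_odd c q : n = 0 ->
  halts (tester_time c q) (start (tester reject_odd c)) /\
  forall b,
    prob b (tester_time c q) (start (tester reject_odd c)) = (b : nat)%:R%R.
Proof.
move=> n0.
have [|halt p] := @leads_halted _ eps n d adj 2 (tester_time c q)
    (start (tester reject_odd c)) (update (fun=> 0) 0 1) _ isT.
  rewrite -[2]/(1 + 1); apply: leads_trans; first exact: leads_step.
  by rewrite eval_not /= (introT eqP n0); apply: leads_step.
by split=> // b; rewrite p; case: b.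
Qed.

Lemma tester_reject_odd c q : odd n ->
  halts (tester_time c q) (start (tester true c)) /\
  forall b, prob b (tester_time c q) (start (tester true c)) = (~~ b)%:R%R.
Proof.
move=> odd_n.
have [|halt p] := @leads_halted _ eps n d adj 3 (tester_time c q)
    (start (tester true c)) (fun=> 0) _ isT.
  rewrite -[3]/(1 + (1 + 1)); apply: leads_trans; first exact: leads_step.
  rewrite eval_not /= -lt0n odd_gt0 //.
  apply: leads_trans; first exact: leads_step.
  by rewrite eval_and /= modn2 odd_n; apply: leads_step.
by split=> // b; rewrite p; case: b.
Qed.

Variable tau : rtype r.
Hypothesis max_degree_G : max_degree G <= d.
Hypothesis adjP : adj_lists G adj.
Hypothesis n_gt0 : 0 < n.
Hypothesis tauB : forall v,
  has_type tau G v <-> exists f : bvertex B -> 'I_n, ball_emb r G v f.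
Local Notation S := (type_set tau G).

Lemma runs_check (m : memory) (x : 'I_n) : m 3 = x ->
  exists m', [/\ runs eps d adj check_cmd check_time m m', m' 2 = m 2 - 1 &
                 (m' 0 != 0) = (x \notin S) && (m 0 != 0)].
Proof.
move=> m_x; pose m_root := update m 3 (m 3 + 1).
pose m_tree := loaded d adj m_root load_size.
have low a : a < 3 -> m_tree a = m a.
  move=> a3; rewrite /m_tree loaded_low ?(ltnW a3) // /m_root /update.
  by rewrite ltn_eqF.
have m_treeP : holds_walk_tree r d adj x m_tree.
  by apply: loaded_walk_tree; rewrite // /m_root /update eqxx m_x addn1.
have typeE : (eval eps n m_tree (expr_type r d B) != 0) = (x \in S).
  have eval_m_tree := eval_type_ball_emb B max_degree_G adjP m_treeP eps.
  by apply/idP/type_setP => [/eval_m_tree/tauB|/tauB/eval_m_tree].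
pose m_verdict := if x \in S then update m_tree 0 0 else m_tree.
exists (update m_verdict 2 (m_verdict 2 - 1)); split.
- have -> : check_time = (1 + (load_size.*2.+1 + (2 + 1).+1).+1).+1.
    by rewrite /check_time; lia.
  apply: runs_seq; first exact: runs_store.
  apply: runs_seq; first exact: (@runs_load _ eps n d adj m_root 0 load_size).
  apply: (runs_seq (m2 := m_verdict)); last exact: runs_store.
  apply: runs_if; rewrite typeE /m_verdict.
  case: (x \in S); first exact: runs_store.
  exact: runs_skip.
- by rewrite /update eqxx /m_verdict; case: (x \in S); rewrite /update /= low.
- by rewrite /update /= /m_verdict; case: (x \in S); rewrite /update /= ?low.
Qed.

Lemma runs_uniform_sample m : exists mx : 'I_n -> memory,
  [/\ runs_uniform eps d adj sample_cmd check_time.+2 m mx,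
      forall x, mx x 2 = m 2 - 1 &
      forall x, (mx x 0 != 0) = (x \notin S) && (m 0 != 0)].
Proof.
have ex_mx (x : 'I_n) : exists m',
    [/\ runs eps d adj check_cmd check_time (update m 3 x) m',
    m' 2 = m 2 - 1 & (m' 0 != 0) = (x \notin S) && (m 0 != 0)].
  by have [m' []] := @runs_check (update m 3 x) x erefl; exists m'.
have [mx mxP] := boolp.choice ex_mx.
exists mx; split=> [|x|x]; try by case: (mxP x).
by apply: runs_uniform_rand => // x; case: (mxP x).
Qed.

Definition type_density : R := (#|S|%:R / n%:R)%R.

Lemma type_density01 : (0 <= type_density <= 1)%R.
Proof.
rewrite /type_density divr_ge0 ?ler0n //= ler_pdivrMr ?ltr0n // mul1r ler_nat.
by rewrite -[X in _ <= X]card_ord max_card.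
Qed.

Lemma avg_if_type_set (y z : R) :
  ((\sum_x (if x \in S then y else z)) / n%:R =
   type_density * y + (1 - type_density) * z)%R.
Proof.
have n_neq0 : (n%:R != 0 :> R)%R by rewrite pnatr_eq0 -lt0n.
by rewrite sum_if_set card_ord /type_density; field.
Qed.

Lemma sample_loop_prob j m t : m 2 = j ->
  halts (j * check_time.+3 + t.+1) ([:: sample_loop], m) /\
  forall b, prob b (j * check_time.+3 + t.+1) ([:: sample_loop], m) =
    samples_prob type_density j (m 0 != 0) b.
Proof.
elim: j m => [|j IHj] m m2.
  have [|halt p] := @leads_halted _ eps n d adj 1 t.+1
      ([:: sample_loop], m) m _ isT.
    by apply: leads_step; rewrite /= m2.
  by split=> // b; rewrite p samples_prob0.
rewrite mulSn -addnA addSn -add1n; set T := j * _ + _ in IHj *.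
have lead : leads eps d adj 1 ([:: sample_loop], m)
    ([:: sample_cmd; sample_loop], m).
  by apply: leads_step; rewrite /= m2.
have [prob1 halts1] := lead (check_time.+2 + T).
have [mx [run_mx mx2 mx0]] := runs_uniform_sample m.
have [prob2 halts2] := run_mx [:: sample_loop] T.
have IHmx x : halts T ([:: sample_loop], mx x) /\
    forall b, prob b T ([:: sample_loop], mx x) =
      samples_prob type_density j ((x \notin S) && (m 0 != 0)) b.
  by rewrite -mx0; apply: IHj; rewrite mx2 m2 subn1.
rewrite halts1; split=> [|b]; first by apply: halts2 => x; case: (IHmx x).
rewrite prob1 prob2 samples_probS -avg_if_type_set; congr (_ / _)%R.
by apply: eq_bigr => x _; rewrite (IHmx x).2; case: (x \in S).
Qed.

Lemma tester_starts_sampling reject_odd c :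
  (0 < eps)%R -> ~~ (reject_odd && odd n) ->
  exists m, [/\ m 2 = c * inv_ceil eps, m 0 = 1 &
    leads eps d adj (8 + (inv_ceil eps).*2) (start (tester reject_odd c))
      ([:: sample_loop], m)].
Proof.
move=> eps_gt0 no_reject; set q := inv_ceil eps.
have [|m [run_m m1 m0]] :=
    @runs_search_inv_eps _ eps n d adj q (update (fun=> 0) 0 1).
  by move=> i; rewrite inv_ceilP.
exists (update m 2 (c * q)); split=> //.
have -> : 8 + q.*2 = 1 + (1 + (1 + (1 + (1 + (q.*2.+1 + (1 + 1)))))) by lia.
apply: leads_trans; first exact: leads_step.
rewrite eval_not /= -lt0n n_gt0 /=; apply: leads_trans; first exact: leads_step.
rewrite eval_and /= modn2 !eqb0 !negbK (negbTE no_reject).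
apply: leads_trans; first exact: leads_step.
apply: leads_trans; first exact: leads_step.
apply: leads_trans; first exact: leads_step.
apply: leads_trans; first exact: run_m.
apply: leads_trans; first exact: leads_step.
by apply: leads_step; rewrite /= m1.
Qed.

Lemma tester_prob reject_odd c : (0 < eps)%R -> ~~ (reject_odd && odd n) ->
  halts (tester_time c (inv_ceil eps)) (start (tester reject_odd c)) /\
  forall b,
    prob b (tester_time c (inv_ceil eps)) (start (tester reject_odd c)) =
    samples_prob type_density (c * inv_ceil eps) true b.
Proof.
move=> eps_gt0 /(tester_starts_sampling c eps_gt0)[m [m2 m0 lead]].
have [prob_lead halts_lead] := lead (c * inv_ceil eps * check_time.+3 + 2).
have -> : tester_time c (inv_ceil eps) =
    8 + (inv_ceil eps).*2 + (c * inv_ceil eps * check_time.+3 + 2).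
  by rewrite /tester_time; lia.
have [halt p] := sample_loop_prob 1 m2.
by rewrite halts_lead; split=> // b; rewrite prob_lead p m0.
Qed.

Lemma samples_prob_accept j :
  nbhd_free tau G -> samples_prob type_density j true true = 1%R.
Proof.
move=> /nbhd_free_type_set S0.
by rewrite /samples_prob /type_density S0 cards0 mul0r subr0 expr1n.
Qed.

Lemma samples_prob_reject c : (0 < eps)%R ->
  (eps * n%:R <= c%:R * #|S|%:R)%R ->
  (2 / 3 <= samples_prob type_density (c.*2 * inv_ceil eps) true false)%R.
Proof.
move=> eps_gt0 le_S; set q := inv_ceil eps.
suff : ((1 - type_density) ^+ (c.*2 * q) <= 1 / 3)%R.
  by rewrite /samples_prob; lra.
apply: onem_exp_le_third type_density01 _.
have nR : (0 < n%:R :> R)%R by rewrite ltr0n.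
rewrite /type_density mulrA ler_pdivlMr // natrM -muln2 natrM.
have le_q : (1 * n%:R <= eps * q%:R * n%:R)%R by rewrite ler_pM2r // inv_ceilP.
have : (eps * n%:R * q%:R <= c%:R * #|S|%:R * q%:R)%R by rewrite ler_wpM2r.
lra.
Qed.

End Tester.

Section FarGraphs.
Variables (R : realType) (r d' d : nat) (tau : rtype r).
Hypothesis r_gt0 : 0 < r.
Hypothesis d'_lt_d : d' < d.
Hypothesis degree_tau : rtype_degree_le tau d'.

Lemma eps_far_type_set_gt0 (eps : R) n (G : graph 'I_n) : (0 < eps)%R ->
  max_degree G <= d -> eps_far d (nbhd_free tau) eps G -> 0 < #|type_set tau G|.
Proof.
move=> eps_gt0 dG farG; rewrite lt0n cards_eq0.
apply/eqP => /nbhd_free_type_set freeG.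
have := farG G dG freeG.
by rewrite edit_dist_refl ltNge !mulr_ge0 ?ler0n // ltW.
Qed.

Lemma ex_eps_far_card : exists c, forall (eps : R) n (G : graph 'I_n),
  (0 < eps <= 1)%R -> ~~ (odd_obstruction d tau && odd n) ->
  max_degree G <= d -> eps_far d (nbhd_free tau) eps G ->
  (eps * n%:R <= c%:R * #|type_set tau G|%:R)%R.
Proof.
have [c [n0 removal]] := ex_removal r_gt0 d'_lt_d degree_tau.
exists (c + n0) => eps n G /andP[eps_gt0 eps_le1] no_obs dG farG.
rewrite -natrM; have [n0n|nn0] := leqP n0 n.
  have [H [dH freeH eH]] := removal n G n0n (no_odd_obstruction no_obs) dG.
  apply: (@le_trans _ _ (eps * d%:R * n%:R)%R).
    rewrite ler_wpM2r //; apply: ler_peMr; first exact: ltW.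
    by rewrite ler1n (leq_ltn_trans _ d'_lt_d).
  apply: le_trans (ltW (farG H dH freeH)) _.
  by rewrite ler_nat (leq_trans eH) // leq_mul2r leq_addr orbT.
apply: (@le_trans _ _ n%:R%R); first by rewrite ler_piMl.
have S_gt0 := eps_far_type_set_gt0 eps_gt0 dG farG.
rewrite ler_nat (leq_trans (ltnW nn0)) // (leq_trans (leq_addl c n0)) //.
exact: leq_pmulr.
Qed.

End FarGraphs.

Theorem theorem8p2 (R : realType) (r d d' : nat) (tau : rtype r)
    (hr : 1 <= r) (hd : d' < d)
    (htau : forall B : rooted, tau B -> max_degree (bgraph B) <= d') :
  uniformly_testable_const_time R d (nbhd_free tau).
Proof.
have [B _ tauB] := rtype_rep tau.
have [c farP] := ex_eps_far_card R hr hd htau.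
exists (tester r d B (odd_obstruction d tau) c.*2).
exists (fun eps => tester_time r d c.*2 (inv_ceil eps)).
move=> eps eps01 n G adj dG adjP; have /andP[eps_gt0 _] := eps01.
set q := inv_ceil eps.
have [n0|n_gt0] := posnP n.
  have [halt p] := tester_empty r d B eps adj (odd_obstruction d tau) c.*2 q n0.
  split=> [//|_|farG]; first by rewrite p /=; lra.
  have /card_gt0P[v _] := eps_far_type_set_gt0 eps_gt0 dG farG.
  by have := leq_trans (ltn_ord v) (eq_leq n0).
have [/andP[obs odd_n]|no_obs] := boolP (odd_obstruction d tau && odd n).
  have [halt p] := tester_reject_odd r d B eps adj c.*2 q odd_n.
  rewrite obs; split=> [//|freeG|_]; last by rewrite p /=; lra.
  by have := odd_obstruction_free obs odd_n dG freeG.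
have [halt p] := tester_prob dG adjP n_gt0 (tauB _ G) c.*2 eps_gt0 no_obs.
split=> [//|freeG|farG]; rewrite p.
  by rewrite samples_prob_accept //; lra.
by apply: samples_prob_reject => //; apply: farP.
Qed.
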